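(* Let $M$ be an anisotropic quadratic lattice over $\mathbb{Z}_p$ of rank $2$ with $\mathrm{GK}(M)=(a_1,a_2)$, and put $\mathcal{T}_{a_1,a_2}=\sum_{x=0}^{a_1}\sum_{y=0}^{a_2}p^{\min\{a_1-x+y,\ a_2-y+x\}}$. Then \[ \mathcal{T}_{a_1,a_2}=\frac{-1}{p-1}\,\mathcal{F}'_M(1/p), \] where $\mathcal{F}'_M$ is the derivative of the Siegel series $\mathcal{F}_M(X)$.
   Context: $p$ is any prime. A quadratic lattice over $\mathbb{Z}_p$ is a free $\mathbb{Z}_p$-module $L$ of rank $n$ with quadratic form $q_L:L\to\mathbb{Z}_p$ and $L\otimes\mathbb{Q}_p$ nondegenerate; anisotropic means $q_L(x)\neq0$ for $x\neq0$. Gram matrix $B$: $b_{ii}=q(e_i)$, $b_{ij}=\frac12(q(e_i+e_j)-q(e_i)-q(e_j))$; $S(B)$: non-decreasing $(a_i)\in\mathbb{Z}^n_{\ge0}$ with $\mathrm{ord}_p(b_{ii})\ge a_i$, $\mathrm{ord}_p(2b_{ij})\ge(a_i+a_j)/2$; $\mathrm{GK}(L)$ is the lexicographically greatest element of $\bigcup_{U\in\mathrm{GL}_n(\mathbb{Z}_p)}S({}^tUBU)$. $H_k=\mathbb{Z}_p^{2k}$ with $q_k=\sum_{i\le k}x_iy_i$; for $k\ge n$, $\alpha(L,H_k)=\lim_N p^{-N(2kn-n(n+1)/2)}\#\{\varphi:L/p^N\to H_k/p^N\text{ linear}:q_k\circ\varphi\equiv q_L\bmod p^N\}$, and the Siegel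 series $\mathcal{F}_L(X)$ is the polynomial with $\mathcal{F}_L(p^{-k})=\alpha(L,H_k)$ for all $k\ge n$. *)

(* Defs.v *)
From HB Require Import structures.
From mathcomp Require Import all_boot all_order all_algebra.
From mathcomp Require Import all_classical all_reals all_analysis.
Set Implicit Arguments.
Unset Strict Implicit.
Unset Printing Implicit Defensive.
Import Order.TTheory GRing.Theory Num.Theory.
Import VectorInternalTheory numFieldNormedType.Exports.

Local Open Scope ring_scope.

(* Z_p as the inverse limit of the Z/p^n: [x n] is the representative of the
   residue of [x] mod [p ^ n] in [0, p ^ n). *)
Record padic_int (p : nat) (p_pr : prime p) : Type := PadicInt {
  residue :> nat -> nat;
  residueP : forall n, (residue n.+1 %% p ^ n)%N = residue n
}.

Section PadicInt.
Context (p : nat) (p_pr : prime p).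
Local Notation Zp := (padic_int p_pr).

HB.instance Definition _ := gen_eqMixin Zp.
HB.instance Definition _ := gen_choiceMixin Zp.

Lemma padic_eqP (x y : Zp) : (forall n, x n = y n) -> x = y.
Proof.
case: x y => [x xP] [y yP] /= /funext exy; subst y.
by rewrite (Prop_irrelevance xP yP).
Qed.

Lemma residue_mod (x : Zp) n : (x n %% p ^ n)%N = x n.
Proof. by rewrite -[X in (X %% _)%N](residueP x) modn_mod residueP. Qed.

Lemma residue_lt (x : Zp) n : (x n < p ^ n)%N.
Proof. by rewrite -residue_mod ltn_mod expn_gt0 prime_gt0. Qed.

Lemma residue_le (x : Zp) m n : (m <= n)%N -> (x n %% p ^ m)%N = x m.
Proof.
move=> /subnK <-; elim: (n - m)%N => [|k IHk]; first exact: residue_mod.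
by rewrite addSn -IHk -(residueP x (k + m)) modn_dvdm // dvdn_exp2l ?leq_addl.
Qed.

Definition padic_of (f : nat -> nat)
    (fP : forall n, (f n.+1 = f n %[mod p ^ n])%N) : Zp.
Proof.
exists (fun n => (f n %% p ^ n)%N) => n.
by rewrite modn_dvdm ?dvdn_exp2l.
Defined.

Fact padic_nat_subproof (m : nat) (n : nat) : (m = m %[mod p ^ n])%N.
Proof. by []. Qed.

Fact padic_add_subproof (x y : Zp) n :
  (x n.+1 + y n.+1 = x n + y n %[mod p ^ n])%N.
Proof. by rewrite -modnDm !residueP. Qed.

Fact padic_mul_subproof (x y : Zp) n :
  (x n.+1 * y n.+1 = x n * y n %[mod p ^ n])%N.
Proof. by rewrite -modnMm !residueP. Qed.

Fact padic_opp_subproof (x : Zp) n :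
  (p ^ n.+1 - x n.+1 = p ^ n - x n %[mod p ^ n])%N.
Proof.
apply/eqP; rewrite -(eqn_modDr (x n.+1)) subnK ?(ltnW (residue_lt _ _)) //.
rewrite -modnDmr residueP subnK ?(ltnW (residue_lt _ _)) //.
by rewrite modnn expnS modnMl.
Qed.

Definition padic_zero : Zp := padic_of (padic_nat_subproof 0).
Definition padic_one : Zp := padic_of (padic_nat_subproof 1).
Definition padic_add (x y : Zp) : Zp := padic_of (padic_add_subproof x y).
Definition padic_mul (x y : Zp) : Zp := padic_of (padic_mul_subproof x y).
Definition padic_opp (x : Zp) : Zp := padic_of (padic_opp_subproof x).

Fact padic_addA : associative padic_add.
Proof. by move=> x y z; apply: padic_eqP => n /=; rewrite modnDmr modnDml addnA. Qed.

Fact padic_addC : commutative padic_add.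
Proof. by move=> x y; apply: padic_eqP => n /=; rewrite addnC. Qed.

Fact padic_add0 : left_id padic_zero padic_add.
Proof. by move=> x; apply: padic_eqP => n /=; rewrite mod0n residue_mod. Qed.

Fact padic_addN : left_inverse padic_zero padic_opp padic_add.
Proof.
move=> x; apply: padic_eqP => n /=.
by rewrite modnDml subnK ?(ltnW (residue_lt _ _)) // modnn mod0n.
Qed.

HB.instance Definition _ := GRing.isZmodule.Build Zp
  padic_addA padic_addC padic_add0 padic_addN.

Fact padic_mulA : associative padic_mul.
Proof. by move=> x y z; apply: padic_eqP => n /=; rewrite modnMmr modnMml mulnA. Qed.

Fact padic_mulC : commutative padic_mul.
Proof. by move=> x y; apply: padic_eqP => n /=; rewrite mulnC. Qed.

Fact padic_mul1 : left_id padic_one padic_mul.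
Proof. by move=> x; apply: padic_eqP => n /=; rewrite modnMml mul1n residue_mod. Qed.

Fact padic_mulDl : left_distributive padic_mul padic_add.
Proof.
by move=> x y z; apply: padic_eqP => n /=; rewrite modnMml modnDm mulnDl.
Qed.

Fact padic_one_neq0 : padic_one != padic_zero.
Proof.
apply/eqP => /(congr1 (fun x : Zp => x 1)) /=.
by rewrite mod0n modn_small // expn1 prime_gt1.
Qed.

HB.instance Definition _ := GRing.Zmodule_isComNzRing.Build Zp
  padic_mulA padic_mulC padic_mul1 padic_mulDl padic_one_neq0.

Definition padic_unit : {pred Zp} := fun x => `[< exists y, y * x = 1 >].
Definition padic_inv (x : Zp) : Zp :=
  if x \in padic_unit then xget 0 [set y | y * x = 1]%classic else x.

Fact padic_mulVx : {in padic_unit, left_inverse 1 padic_inv *%R}.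
Proof.
move=> x x_unit; rewrite /padic_inv x_unit.
by case: xgetP => [y _ //|noy]; move: x_unit => /asboolP[y /noy].
Qed.

Fact padic_unitPl (x y : Zp) : y * x = 1 -> padic_unit x.
Proof. by move=> yx1; apply/asboolP; exists y. Qed.

Fact padic_inv_out : {in [predC padic_unit], padic_inv =1 id}.
Proof. by move=> x; rewrite inE /padic_inv => /negbTE ->. Qed.

HB.instance Definition _ := GRing.ComNzRing_hasMulInverse.Build Zp
  padic_mulVx padic_unitPl padic_inv_out.

Lemma padic_neq0P (x : Zp) : reflect (exists n, x n <> 0) (x != 0).
Proof.
apply: (iffP idP) => [x_neq0|[n xn]]; last first.
  by apply/eqP => x0; apply: xn; rewrite x0 /= mod0n.
apply: contrapT => nox; move/eqP: x_neq0; apply.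
apply: padic_eqP => n /=; rewrite mod0n.
by apply: contrapT => xn; apply: nox; exists n.
Qed.

Fact padic_integral : GRing.integral_domain_axiom Zp.
Proof.
move=> x y xy0; apply: contrapT => /negP; rewrite negb_or.
move=> /andP[/padic_neq0P[m xm] /padic_neq0P[n yn]].
have : (x * y) (m + n)%N = 0 by rewrite xy0 /= mod0n.
move=> /= /eqP; rewrite -/(dvdn _ _).
have logx (z : Zp) k l : z k <> 0 -> (k <= l)%N ->
    (0 < z l)%N /\ (logn p (z l) < k)%N.
  move=> zk kl.
  have zl : ~~ (p ^ k %| z l)%N by rewrite /dvdn residue_le //; apply/eqP.
  have zl0 : (0 < z l)%N by rewrite lt0n; apply: contraNneq zl => ->.
  by split=> //; rewrite ltnNge -pfactor_dvdn.
have [x0 lx] := logx _ _ (m + n)%N xm (leq_addr _ _).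
have [y0 ly] := logx _ _ (m + n)%N yn (leq_addl _ _).
rewrite pfactor_dvdn ?muln_gt0 ?x0 // lognM // leqNgt.
by rewrite (leq_trans _ (leq_add lx (ltnW ly))) // addSn.
Qed.

HB.instance Definition _ := GRing.ComUnitRing_isIntegral.Build Zp padic_integral.

End PadicInt.

Notation padic p_pr := {fraction (padic_int p_pr)}.

Section QuadraticLattices.
Context (p : nat) (p_pr : prime p).
Local Notation Zp := (padic_int p_pr).
Local Notation Qp := (padic p_pr).

(* Additive p-adic valuation, with ord_p 0 = +oo; the values are rationals so
   that they can be compared with half-integers. *)
Definition ordp (x : Qp) : \bar rat :=
  if x == 0 then +oo%E
  else (xget 0 [set m : int | exists2 u : Zp, u \is a GRing.unit
                            & x = (p%:R : Qp) ^ m * tofrac u]%classic)%:~R%:E.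

Definition polar (V : lmodType Zp) (q : V -> Zp) (x y : V) : Zp :=
  q (x + y) - q x - q y.

(* [polar q] is symmetric, so linearity in one argument is bilinearity. *)
Definition quadratic_form (V : lmodType Zp) (q : V -> Zp) : Prop :=
  (forall a x, q (a *: x) = a ^+ 2 * q x) /\
  (forall a x y z, polar q (a *: x + y) z = a * polar q x z + polar q y z).

Definition ord_ge (x : Qp) (r : rat) : Prop := (r%:E <= ordp x)%E.

(* A [vectType Zp] is a Zp-module with an isomorphism [v2r] onto 'rV[Zp]_n,
   n = dim L, that is, a free module with a distinguished basis. *)
Definition lattice_basis (L : vectType Zp) (i : 'I_(dim L)) : L :=
  r2v (delta_mx 0 i).

Definition gram (L : vectType Zp) (q : L -> Zp) : 'M[Qp]_(dim L) :=
  \matrix_(i, j)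
    if i == j then tofrac (q (lattice_basis i))
    else 2%:R^-1 * tofrac (polar q (lattice_basis i) (lattice_basis j)).

Definition nondegenerate n (B : 'M[Qp]_n) : Prop :=
  forall x : 'rV[Qp]_n,
    (forall y : 'rV[Qp]_n, x *m B *m y^T = 0) -> x = 0.

Record quad_lattice : Type := QuadLattice {
  lattice :> vectType Zp;
  qform : lattice -> Zp;
  qform_quadratic : quadratic_form qform;
  (* the form on L (x) Q_p, in coordinates *)
  qform_nondegenerate : nondegenerate (gram qform)
}.

Definition rank (L : quad_lattice) : nat := dim L.

Definition anisotropic (L : quad_lattice) : Prop :=
  forall x : L, x != 0 -> qform x != 0.

(* The set S(B). *)
Definition gk_admissible n (B : 'M[Qp]_n) (a : seq nat) : Prop :=
  [/\ size a = n, sorted leq a,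
      forall i : 'I_n, ord_ge (B i i) (nth 0%N a i)%:R
    & forall i j : 'I_n, i != j ->
        ord_ge (2%:R * B i j) ((nth 0%N a i + nth 0%N a j)%:R / 2%:R)].

Definition gk_candidate (L : quad_lattice) (a : seq nat) : Prop :=
  exists2 U : 'M[Zp]_(rank L), U \in unitmx
    & let U' := map_mx (@tofrac Zp) U in
      gk_admissible (U'^T *m gram (@qform L) *m U') a.

(* GK(L) = a *)
Definition is_GK (L : quad_lattice) (a : seq nat) : Prop :=
  gk_candidate L a /\
  forall b, gk_candidate L b -> ((b : seqlexi nat) <= (a : seqlexi nat))%O.

(* The form q_k on A^{2k}, with coordinates (x_1, .., x_k, y_1, .., y_k). *)
Definition hyperbolic (A : comNzRingType) k (v : 'rV[A]_(k + k)) : A :=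
  \sum_(i < k) v 0 (lshift k i) * v 0 (rshift k i).

(* Reduction mod p ^ N; meaningful for N > 0 only, since 'Z_1 is Z/2. *)
Definition reduction N (x : Zp) : 'Z_(p ^ N) := (x N)%:R.

(* A linear map L / p^N -> H_k / p^N is the same thing as a matrix over
   Z / p^N, acting on the right on the reduced coordinate vector of x. *)
Definition lattice_homs (L : quad_lattice) k N :
    {set 'M['Z_(p ^ N)]_(rank L, k + k)} :=
  [set phi | `[< forall x : L,
     hyperbolic (map_mx (@reduction N) (v2r x) *m phi)
     = reduction N (qform x) >] ].

End QuadraticLattices.

(* The sequence is indexed from N = 1. *)
Definition local_density (R : realType) (p : nat) (p_pr : prime p)
    (L : quad_lattice p_pr) (k : nat) : R :=
  let n := rank L in
  lim ((fun N : nat =>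
    #|lattice_homs L k N.+1|%:R
    / (p%:R : R) ^+ (N.+1 * (2 * k * n - (n * n.+1)./2))) @ \oo)%classic.

(* The unique polynomial interpolating the local densities. *)
Definition siegel_series (R : realType) (p : nat) (p_pr : prime p)
    (L : quad_lattice p_pr) : {poly R} :=
  xget 0 [set F : {poly R} | forall k, (rank L <= k)%N ->
            F.[(p%:R ^+ k)^-1] = local_density R L k]%classic.

Definition T_sum (p a1 a2 : nat) : nat :=
  \sum_(x < a1.+1) \sum_(y < a2.+1) p ^ minn (a1 - x + y) (a2 - y + x).

(* Main.v *)
(* A linear map into [H_k] is a pair [X | Y] of 2 x k matrices, and the condition
   on it is linear in [Y]. Modulo [p ^ N], sort the [X] by the cokernel of their
   column span: [p ^ i] is the content of [X], and [X / p ^ i] has one primitive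
   row modulo which the other one has content [p ^ d], for a point of
   P^1(Z / p^d). The equations in [Y] are solvable exactly when
   [p ^ i] divides the form and [p ^ (i + d)] divides its value at that point, so
   F(X) = (1 - X) (1 - p X) sum_{i,d} p^(3i+d) X^(2i+d) nu(i,d) with nu(i,d) the
   number of such points. The factor 1 - p X kills all but one term of
   the derivative at 1/p. Maximality of GK(M), together with Hensel's lemma and
   anisotropy, provides a basis e, f with ord q(x e + y f) equal to
   min(a1 + 2 ord x, a2 + 2 ord y), which determines nu; the resulting sum
   is T_{a1,a2} cut into symmetric chains of the rectangle [0,a1] x [0,a2]. *)
From HB Require Import structures.
Require Import Defs.
From mathcomp Require Import all_boot all_order all_algebra.
From mathcomp Require Import all_classical all_reals all_analysis.
From mathcomp Require Import ring zify.
Set Implicit Arguments.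
Unset Strict Implicit.
Unset Printing Implicit Defensive.
Import Order.TTheory GRing.Theory Num.Theory.
Import VectorInternalTheory numFieldNormedType.Exports.

(** * The sum over the rectangle *)

(** Induction on [a]: on the hook formed by the row [x = 0] and the last column, [x + y] takes each
    value from 0 to [a + b] exactly once, and removing it leaves a smaller rectangle with [x]
    shifted by one. *)
Lemma sum_rect_hooks (g : nat -> nat) a b : a <= b ->
  \sum_(x < a.+1) \sum_(y < b.+1) g (x + y)
  = \sum_(i < a.+1) \sum_(i <= m < (a + b - i).+1) g m.
Proof.
elim: a b g => [|a IHa] b g ab.
  by rewrite !big_ord1 subn0 big_mkord; apply: eq_bigr.
case: b ab => // b ab.
rewrite [RHS]big_ord_recl subn0 [LHS]big_ord_recl /=.
under [X in _ + X = _]eq_bigr => x _ do rewrite big_ord_recr /=.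
rewrite big_split /= addnCA addnC; congr (_ + _).
  rewrite (big_cat_nat (n := b.+2)) //=; last by lia.
  rewrite big_mkord; congr (_ + _).
  rewrite -{1}[b.+2]add0n big_addn big_mkord.
  have -> : (a.+1 + b.+1).+1 - b.+2 = a.+1 by lia.
  by apply: eq_bigr => x _; congr g; rewrite /= /bump /=; lia.
transitivity (\sum_(x < a.+1) \sum_(y < b.+1) g (x + y).+1).
  by apply: eq_bigr => x _; apply: eq_bigr => y _.
rewrite (IHa b (fun m => g m.+1)) //.
apply: eq_bigr => i _; rewrite [RHS]big_add1 /bump /=; apply: congr_big_nat => //; have := ltn_ord i; lia.
Qed.

(** Both sides run through the exponents [i, i, i + 1, i + 1, ...] up to [m / 2], the last one
    occurring once if [m] is even. The induction removes the two ends [l = i] and [l = m - i], which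
    match [2i] and [2i + 1] on the right. *)
Lemma sum_min_half p i m :
  \sum_(i <= l < m.+1 - i) p ^ minn l (m - l) = \sum_(i.*2 <= l < m.+1) p ^ l./2.
Proof.
have [d] := ubnP (m.+1 - i.*2); elim: d i => // d IHd i ltd.
have [mi|] := leqP m.+1 i.*2; first by rewrite !big_geq //; lia.
rewrite leq_eqVlt => /predU1P[mi|mi].
  have -> : m.+1 - i = i.+1 by lia.
  rewrite -mi !big_nat1 doubleK; congr (_ ^ _); lia.
rewrite [RHS]big_ltn; last by lia.
rewrite [X in _ = _ + X]big_ltn; last by lia.
rewrite -doubleS -IHd; last by rewrite doubleS; lia.
rewrite big_ltn; last by lia.
have -> : m.+1 - i = (m.+1 - i.+1).+1 by lia.
rewrite big_nat_recr /=; last by lia.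
have -> : minn i (m - i) = i by lia.
have -> : minn (m.+1 - i.+1) (m - (m.+1 - i.+1)) = i by lia.
rewrite ?uphalf_double.
rewrite doubleK; lia.
Qed.

Lemma T_sum_eq p a b : a <= b ->
  T_sum p a b = \sum_(i < a.+1) \sum_(i.*2 <= l < (a + b).+1) p ^ l./2.
Proof.
move=> ab; under eq_bigr => i _ do rewrite -sum_min_half.
have -> : T_sum p a b = \sum_(x < a.+1) \sum_(y < b.+1)
    p ^ minn (x + y) (a + b - (x + y)).
  (* Replacing [x] by [a - x] makes the exponent a function of [x + y] alone. *)
  rewrite /T_sum [LHS](reindex_inj rev_ord_inj) /=.
  apply: eq_bigr => x _; apply: eq_bigr => y _; congr (_ ^ _).
  have := ltn_ord x; have := ltn_ord y; lia.
rewrite (sum_rect_hooks (fun m => p ^ minn m (a + b - m))) //.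
by apply: eq_bigr => i _; apply: congr_big_nat => //; have := ltn_ord i; lia.
Qed.

Local Open Scope ring_scope.

(** * p-adic integers *)

Section PadicIntegers.
Context (p : nat) (p_pr : prime p).
Local Notation Zp := (padic_int p_pr).
Implicit Types (x y z : Zp) (e : nat).

(** Orders are expressed by [pdvd e x] for varying [e], which covers [x = 0] without an infinite
    value. *)
Definition pdvd e x := x e == 0%N.

Lemma residueD x y e : (x + y) e = ((x e + y e) %% p ^ e)%N. Proof. by []. Qed.
Lemma residueM x y e : (x * y) e = ((x e * y e) %% p ^ e)%N. Proof. by []. Qed.

Lemma residue_nat m e : (m%:R : Zp) e = (m %% p ^ e)%N.
Proof.
elim: m => [|m IHm] //; rewrite -addn1 natrD residueD IHm.
by rewrite [(1%:R : Zp) e]/= modnDm.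
Qed.

Lemma pdvdP e x : reflect (exists y, x = p%:R ^+ e * y) (pdvd e x).
Proof.
apply: (iffP eqP) => [xe|[y ->]]; last first.
  by rewrite -natrX residueM residue_nat modnn mul0n mod0n.
(* The quotient modulo [p ^ m] is read off from [x] modulo [p ^ (m + e)]. *)
have yP m : (x (m.+1 + e) %/ p ^ e = x (m + e) %/ p ^ e %[mod p ^ m])%N.
  rewrite [RHS]modn_small; last first.
    by rewrite ltn_divLR ?expn_gt0 ?prime_gt0 // -expnD residue_lt.
  by rewrite modn_divl mulnC -expnD addSn addnC residueP.
exists (padic_of p_pr yP); apply: padic_eqP => m.
have dvd_xe : (p ^ e %| x (m + e))%N by rewrite /dvdn residue_le ?leq_addl // xe.
rewrite -natrX residueM residue_nat /= modnMm mulnC divnK //.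
by rewrite residue_le ?leq_addr.
Qed.

Lemma pdvd_leq d e x : (d <= e)%N -> pdvd e x -> pdvd d x.
Proof. by move=> de; rewrite /pdvd -(residue_le x de) => /eqP ->; rewrite mod0n. Qed.

Lemma pdvdM e x y : pdvd e x -> pdvd e (x * y).
Proof. by rewrite /pdvd residueM => /eqP->; rewrite mul0n mod0n. Qed.

Lemma pdvdD e x y : pdvd e x -> pdvd e y -> pdvd e (x + y).
Proof. by rewrite /pdvd residueD => /eqP-> /eqP->; rewrite mod0n. Qed.

Lemma pdvdDl e x y : pdvd e y -> pdvd e (x + y) = pdvd e x.
Proof.
move=> dy; apply/idP/idP => [dxy|dx]; last exact: pdvdD.
have -> : x = (x + y) + y * (-1) by ring.
by apply: pdvdD => //; apply: pdvdM.
Qed.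

Lemma pdvd0 x : pdvd 0 x.
Proof. by rewrite /pdvd -(residue_mod x 0) modn1. Qed.

Lemma natX_eq0 e : ((p%:R : Zp) ^+ e == 0) = false.
Proof.
rewrite -natrX; apply/eqP => /(congr1 (fun x : Zp => x e.+1)).
rewrite residue_nat [RHS]mod0n modn_small ?ltn_exp2l ?prime_gt1 // => /eqP.
by rewrite expn_eq0 -leqn0 leqNgt prime_gt0.
Qed.

Lemma pdvdX d e x : pdvd (d + e) (p%:R ^+ d * x) = pdvd e x.
Proof.
apply/pdvdP/pdvdP => -[y]; last by move=> ->; exists y; rewrite exprD mulrA.
rewrite exprD -mulrA => /mulfI xE; exists y; apply: xE.
by rewrite natX_eq0.
Qed.

Lemma pdvd1M x y : pdvd 1 (x * y) = pdvd 1 x || pdvd 1 y.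
Proof.
rewrite /pdvd residueM expn1 -[_ == _]/(p %| _)%N Euclid_dvdM //.
by rewrite -[in RHS](residue_mod x) -[in RHS](residue_mod y) expn1.
Qed.

Lemma pdvd_subE e x y : pdvd e (x - y) = (x e == y e).
Proof.
apply/idP/eqP => [/eqP xy|xy].
  by rewrite -[x](subrK y) residueD xy add0n residue_mod.
rewrite /pdvd residueD xy; rewrite -[(_ %% _)%N]/((y - y) e) subrr.
by rewrite -[_ e]/(0 %% _)%N mod0n.
Qed.

(** The limit is diagonal: modulo [p ^ e] it has the residue of [u e]. *)
Lemma padic_complete (u : nat -> Zp) :
  (forall e, pdvd e (u e.+1 - u e)) -> exists l, forall e, pdvd e (l - u e).
Proof.
move=> cu; have lP e : (u e.+1 e.+1 = u e e %[mod p ^ e])%N.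
  by rewrite residueP residue_mod; apply/eqP; rewrite -pdvd_subE.
by exists (padic_of p_pr lP) => e; rewrite pdvd_subE /= residue_mod.
Qed.

Lemma pdvd_all x : (forall e, pdvd e x) -> x = 0.
Proof. by move=> dx; apply: padic_eqP => e; rewrite (eqP (dx e)) -[RHS]/(0 %% _)%N mod0n. Qed.

Lemma neq0_pdvd x : x != 0 -> exists e, ~~ pdvd e x.
Proof. by case/padic_neq0P => e xe; exists e; apply/eqP. Qed.

Lemma padic_factor x : x != 0 -> exists e y, x = p%:R ^+ e * y /\ ~~ pdvd 1 y.
Proof.
move=> x0; have [e0 xe0] := neq0_pdvd x0.
have ex : exists e, ~~ pdvd e x by exists e0.
case: (ex_minnP ex) => -[|e]; first by rewrite pdvd0.
move=> xe emin; have /pdvdP[y xE] : pdvd e x.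
  by apply: contraT => /emin; rewrite ltnn.
exists e, y; split=> //; apply: contraNN xe => dy.
by rewrite xE -addn1 pdvdX.
Qed.

(** Bezout modulo [p] gives [v] with [x v = 1 - p z], and the geometric series inverts [1 - p z]. *)
Lemma padic_unitP x : (x \is a GRing.unit) = ~~ pdvd 1 x.
Proof.
apply/idP/idP => [xu|ndx].
  apply: contraTN isT => dx.
  have : pdvd 1 (x / x) by apply: pdvdM.
  by rewrite mulrV // /pdvd /= modn_small // expn1 prime_gt1.
have x1 : (0 < x 1)%N by rewrite lt0n.
have /(coprimeP _ x1)[[v w] /= vw] : coprime (x 1) p.
  by rewrite coprime_sym prime_coprime // gtnNdvd // -[X in (_ < X)%N]expn1 residue_lt.
have /pdvdP[z xv] : pdvd 1 (1 - x * v%:R).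
  rewrite pdvd_subE residueM residue_nat modnMmr expn1 mulnC.
  have -> : (v * x 1 = 1 + w * p)%N by lia.
  by rewrite addnC modnMDl -[(1 : Zp) 1%N]/(1 %% p ^ 1)%N expn1.
have [e|l ll] := @padic_complete (fun e => \sum_(i < e) (p%:R * z) ^+ i).
  by rewrite big_ord_recr /= addrAC subrr add0r exprMn; apply/pdvdP; exists (z ^+ e).
suff xvl : x * (v%:R * l) = 1 by apply/unitrP; exists (v%:R * l); rewrite [_ * x]mulrC.
rewrite mulrA; apply/eqP; rewrite -subr_eq0.
have xvE : x * v%:R = 1 - p%:R * z by rewrite -[p%:R]expr1 -xv; ring.
apply/eqP/pdvd_all => e; have /pdvdP[y lE] := ll e.
have -> : l = p%:R ^+ e * y + \sum_(i < e) (p%:R * z) ^+ i by rewrite -lE subrK.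
have geom : (1 - p%:R * z) * (\sum_(i < e) (p%:R * z) ^+ i) = 1 - (p%:R * z) ^+ e.
  by rewrite -[in LHS](opprB (p%:R * z)) mulNr -subrX1 opprB.
rewrite xvE mulrDr geom; apply/pdvdP.
exists ((1 - p%:R * z) * y - z ^+ e); rewrite exprMn; ring.
Qed.

(* Newton's iteration with the derivative frozen at the starting point. *)
Lemma hensel_quadratic a b c t :
  pdvd 1 (a * t ^+ 2 + b * t + c) -> ~~ pdvd 1 (2%:R * a * t + b) ->
  exists s, a * s ^+ 2 + b * s + c = 0.
Proof.
move=> ft dt; pose f s := a * s ^+ 2 + b * s + c.
have Du : 2%:R * a * t + b \is a GRing.unit by rewrite padic_unitP.
set D := 2%:R * a * t + b in Du; pose u e := iter e (fun s => s - f s / D) t.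
(* Each step stays in the residue class of [t], where the derivative is congruent to [D] modulo [p],
   and gains one power of [p]. *)
have uP e : pdvd 1 (u e - t) /\ pdvd e.+1 (f (u e)).
  elim: e => [|e [/pdvdP[r ur] /pdvdP[g fu]]].
    by split=> //=; apply/pdvdP; exists 0; rewrite subrr mulr0.
  have uSE : u e.+1 = u e - f (u e) / D by [].
  split.
    rewrite uSE fu addrAC; apply: pdvdD; first by rewrite ur; apply/pdvdP; exists r.
    by apply/pdvdP; exists (- p%:R ^+ e * g / D); rewrite exprS; ring.
  have -> : f (u e.+1) = f (u e) * (D - (2%:R * a * u e + b)) / D + a * (f (u e) / D) ^+ 2.
    transitivity (f (u e) * (D / D) - f (u e) * (2%:R * a * u e + b) / D + a * (f (u e) / D) ^+ 2).
      by rewrite mulrV // uSE /f; ring.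
    by ring.
  have -> : D - (2%:R * a * u e + b) = - (2%:R * a * (u e - t)) by rewrite /D; ring.
  rewrite ur fu; apply/pdvdP.
  exists (- (2%:R * a * r * g) / D + a * p%:R ^+ e * (g / D) ^+ 2).
  by rewrite !exprS; ring.
have [e|l ll] := @padic_complete u.
  have [_ /pdvdP[g fu]] := uP e.
  have -> : u e.+1 - u e = - (f (u e) / D) by rewrite -[u e.+1]/(u e - _); ring.
  by rewrite fu; apply/pdvdP; exists (- (p%:R * g / D)); rewrite exprS; ring.
exists l; apply: pdvd_all => e; have /pdvdP[y lE] := ll e.
have -> : l = p%:R ^+ e * y + u e by rewrite -lE subrK.
have [_ /(pdvd_leq (leqnSn e))/pdvdP[g fu]] := uP e.
apply/pdvdP; exists (g + a * p%:R ^+ e * y ^+ 2 + 2%:R * a * y * u e + b * y).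
by rewrite !mulrDr -fu /f; ring.
Qed.

End PadicIntegers.

(** * Counting modulo p ^ N *)

(** Cuts a decreasing filtration into its successive layers; it serves to sort vectors and matrices
    by content. *)
Lemma sum_filtration (T : finType) (P : nat -> pred T) (f : T -> nat) e D :
  (forall d x, P d.+1 x -> P d x) -> (e <= D)%N ->
  (\sum_(x | P e x) f x =
   \sum_(e <= d < D) \sum_(x | P d x && ~~ P d.+1 x) f x + \sum_(x | P D x) f x)%N.
Proof.
move=> decP /subnK <-; elim: (D - e)%N => [|m IHm]; first by rewrite big_geq.
rewrite IHm addSn big_nat_recr ?leq_addl //= -addnA; congr addn.
rewrite (bigID (P (m + e).+1)) [LHS]addnC /=; congr addn; apply: eq_bigl => x.
by apply: andb_idl; apply: decP.
Qed.

Section ResidueRing.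
Context (p : nat) (p_pr : prime p) (n : nat).
Local Notation N := n.+1.
Local Notation R := 'Z_(p ^ N).
Local Notation V k := 'rV[R]_k.

(** Divisibility of the representative in [[0, p ^ N)]; it agrees with divisibility in the ring for
    [e <= N], whence the bounds in the lemmas below. *)
Definition dv e (x : R) := (p ^ e %| x)%N.

Lemma pN_gt1 : (1 < p ^ N)%N.
Proof. by rewrite -(expn0 p) ltn_exp2l ?prime_gt1. Qed.

Lemma val_lt (x : R) : (x < p ^ N)%N.
Proof. by have := ltn_ord x; rewrite [X in (_ < X)%N]Zp_cast ?pN_gt1. Qed.

Lemma val_mulr (x y : R) : (x * y : R) = (x * y %% p ^ N)%N :> nat.
Proof. by congr (_ %% _)%N; apply: Zp_cast; apply: pN_gt1. Qed.

Lemma val_addr (x y : R) : (x + y : R) = ((x + y)%N %% p ^ N)%N :> nat.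
Proof. by congr (_ %% _)%N; apply: Zp_cast; apply: pN_gt1. Qed.

Lemma val_natr m : (m%:R : R) = (m %% p ^ N)%N :> nat.
Proof. by rewrite val_Zp_nat ?pN_gt1. Qed.

Lemma dvd_modp e m : (e <= N)%N -> (p ^ e %| m %% p ^ N)%N = (p ^ e %| m)%N.
Proof. by move=> eN; rewrite /dvdn modn_dvdm // dvdn_exp2l. Qed.

Lemma dv0 x : dv 0 x. Proof. by rewrite /dv dvd1n. Qed.

Lemma dv_leq d e x : (d <= e)%N -> dv e x -> dv d x.
Proof. by move=> de; apply: dvdn_trans; apply: dvdn_exp2l. Qed.

Lemma dvP e x : (e <= N)%N -> reflect (exists y, x = p%:R ^+ e * y) (dv e x).
Proof.
move=> eN; apply: (iffP idP) => [/dvdnP[m xE]|[y ->]].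
  exists m%:R; rewrite -natrX -natrM mulnC -xE; apply: ord_inj.
  by rewrite val_natr modn_small ?val_lt.
by rewrite /dv -natrX val_mulr dvd_modp // val_natr dvdn_mulr // dvd_modp.
Qed.

Lemma dvD e x y : (e <= N)%N -> dv e x -> dv e y -> dv e (x + y).
Proof.
move=> eN /(dvP _ eN)[x' ->] /(dvP _ eN)[y' ->]; apply/dvP => //.
by exists (x' + y'); rewrite mulrDr.
Qed.

Lemma dvM e x y : (e <= N)%N -> dv e x -> dv e (x * y).
Proof.
move=> eN /(dvP _ eN)[x' ->]; apply/dvP => //.
by exists (x' * y); rewrite mulrA.
Qed.

Lemma dvDl e x y : (e <= N)%N -> dv e y -> dv e (x + y) = dv e x.
Proof.
move=> eN dy; apply/idP/idP => [dxy|dx]; last exact: dvD.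
have -> : x = (x + y) + y * (-1) by ring.
by apply: dvD => //; apply: dvM.
Qed.

Lemma dvX d e x : (d + e <= N)%N -> dv (d + e) (p%:R ^+ d * x) = dv e x.
Proof.
move=> deN; rewrite /dv -natrX val_mulr dvd_modp // val_natr.
have dN : (d < N)%N \/ e = 0%N by lia.
case: dN => [dN|->]; last first.
  by rewrite addn0 dvd1n dvdn_mulr // dvd_modp //; lia.
rewrite [(p ^ d %% _)%N]modn_small ?ltn_exp2l ?prime_gt1 //.
by rewrite expnD dvdn_pmul2l // expn_gt0 prime_gt0.
Qed.

Lemma dv_unit x : ~~ dv 1 x -> x \is a GRing.unit.
Proof.
rewrite /dv expn1 => px; rewrite -[x]natr_Zp unitZpE ?pN_gt1 //.
by rewrite coprimeXl // prime_coprime.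
Qed.

Lemma card_dv e : (e <= N)%N -> #|[pred x | dv e x]| = (p ^ (N - e))%N.
Proof.
move=> eN.
have lt_m (m : 'I_(p ^ (N - e))) : (p ^ e * m < p ^ N)%N.
  have -> : (p ^ N = p ^ e * p ^ (N - e))%N by rewrite -expnD subnKC.
  by rewrite ltn_pmul2l ?expn_gt0 ?prime_gt0.
pose f (m : 'I_(p ^ (N - e))) : R := (p ^ e * m)%:R.
have fE m : f m = (p ^ e * m)%N :> nat by rewrite val_natr modn_small.
have f_inj : injective f.
  move=> m1 m2 /(congr1 val) /=; rewrite !fE => /eqP.
  by rewrite eqn_pmul2l ?expn_gt0 ?prime_gt0 // => /eqP/val_inj.
rewrite -[RHS]card_ord -(card_codom f_inj); apply: eq_card => x.
rewrite !inE; apply/idP/codomP => [/dvdnP[m xE]|[m ->]]; last first.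
  by rewrite /dv fE dvdn_mulr.
have m_lt : (m < p ^ (N - e))%N.
  by rewrite -(ltn_pmul2r (m := p ^ e)) ?expn_gt0 ?prime_gt0 // -xE -expnD subnK // val_lt.
by exists (Ordinal m_lt); apply: ord_inj; rewrite fE /= xE mulnC.
Qed.

(** A nonempty solution set is a translate of the kernel of multiplication by [p ^ e], which
    consists of the multiples of [p ^ (N - e)]. *)
Lemma card_mulX e m : (e <= N)%N ->
  #|[pred s : R | p%:R ^+ e * s == m]| = (dv e m * p ^ e)%N.
Proof.
move=> eN; have [/(dvP _ eN)[m' ->{m}]|ndv] := boolP (dv e m); last first.
  rewrite mul0n; apply: eq_card0 => s; rewrite !inE; apply: contraNF ndv => /eqP <-.
  by apply/dvP => //; exists s.
rewrite mul1n -[in RHS](subKn eN) -card_dv ?leq_subr //.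
rewrite -(fintype.card_image (f := fun s => s - m')) //; last exact: addIr.
apply: eq_card => s; rewrite [RHS]inE.
have -> : (s \in [seq x - m' | x in [pred s0 | p%:R ^+ e * s0 == p%:R ^+ e * m']])
   = (p%:R ^+ e * s == 0).
  apply/fintype.imageP/eqP => [[x + ->]|s0]; first by rewrite inE mulrBr => /eqP->; rewrite subrr.
  by exists (s + m'); rewrite ?inE ?mulrDr ?s0 ?add0r ?addrK.
have -> : (p%:R ^+ e * s == 0) = (nat_of_ord (p%:R ^+ e * s : R) == 0%N) by [].
rewrite -natrX val_mulr val_natr modnMml -/(dvdn _ _) /dv.
by rewrite -{1}(subnKC eN) expnD dvdn_pmul2l // expn_gt0 prime_gt0.
Qed.

(** * Matrices modulo [p ^ N] sorted by content *)

Definition dvmx m k e (X : 'M[R]_(m, k)) := [forall i, forall j, dv e (X i j)].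

Lemma dvmxP m k e (X : 'M[R]_(m, k)) : reflect (forall i j, dv e (X i j)) (dvmx e X).
Proof. by apply: (iffP forallP) => H i; [move=> j; apply: (forallP (H i))|apply/forallP]. Qed.

Lemma dvmx0 m k (X : 'M[R]_(m, k)) : dvmx 0 X.
Proof. by apply/dvmxP => i j; exact: dv0. Qed.

Lemma card_mx_pred m k (P : 'I_m -> 'I_k -> pred R) :
  #|[pred X : 'M[R]_(m, k) | [forall i, forall j, P i j (X i j)]]|
  = (\prod_i \prod_j #|P i j|)%N.
Proof.
rewrite pair_big /=.
transitivity (\prod_(ij : 'I_m * 'I_k) \sum_(x : R) (P ij.1 ij.2 x : nat))%N; last first.
  apply: eq_bigr => ij _; rewrite -sum1_card [RHS]big_mkcond /=.
  by apply: eq_bigr => x _; rewrite unfold_in; case: (P _ _ x).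
rewrite bigA_distr_bigA /= -sum1_card big_mkcond /=.
pose h (f : {ffun 'I_m * 'I_k -> R}) : 'M[R]_(m, k) := \matrix_(i, j) f (i, j).
pose h' (X : 'M[R]_(m, k)) := [ffun ij : 'I_m * 'I_k => X ij.1 ij.2].
have hK : cancel h h' by move=> f; apply/ffunP => -[i j]; rewrite ffunE mxE.
have h'K : cancel h' h by move=> X; apply/matrixP => i j; rewrite mxE ffunE.
rewrite (reindex h) /=; last by exists h' => x _; [exact: hK|exact: h'K].
apply: eq_bigr => f _; rewrite inE.
case: ifPn => [/forallP Pf|].
  rewrite big1 // => -[i j] _ /=.
  by have /forallP/(_ j) := Pf i; rewrite mxE => ->.
rewrite negb_forall => /existsP[i]; rewrite negb_forall => /existsP[j].
by rewrite mxE => /negbTE Pij; rewrite (bigD1 (i, j)) //= Pij.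
Qed.

(** Multiplication by [p ^ e] maps onto the matrices divisible by [p ^ e], with all fibres of size
    [p ^ (e m k)]. *)
Lemma sum_dvmx m k e (f : 'M[R]_(m, k) -> nat) : (e <= N)%N ->
  (\sum_X f (p%:R ^+ e *: X) = p ^ (e * (m * k)) * \sum_(X | dvmx e X) f X)%N.
Proof.
move=> eN; rewrite (partition_big (fun X => p%:R ^+ e *: X) (dvmx e)); last first.
  by move=> X _; apply/dvmxP => i j; rewrite mxE; apply/dvP => //; exists (X i j).
rewrite big_distrr; apply: eq_bigr => X /dvmxP dX.
rewrite (eq_bigr (fun=> f X)) => [|Y /eqP->//].
rewrite (eq_bigl [pred Y : 'M[R]_(m, k) | [forall i, forall j, p%:R ^+ e * Y i j == X i j]]).
  rewrite sum_nat_const; congr (_ * _)%N.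
rewrite (card_mx_pred (fun i j y => p%:R ^+ e * y == X i j)).
rewrite (eq_bigr (fun=> (p ^ e) ^ k)%N) => [|i _].
  by rewrite prod_nat_const card_ord -!expnM [(k * m)%N]mulnC.
rewrite (eq_bigr (fun=> p ^ e)%N) => [|j _]; last by rewrite card_mulX // dX mul1n.
by rewrite prod_nat_const card_ord.
  move=> Y /=; apply/eqP/forallP => [<- i|H]; first by apply/forallP => j; rewrite mxE.
  by apply/matrixP => i j; rewrite mxE; have /forallP/(_ j)/eqP := H i.
Qed.

Lemma card_dvmx m k e : (e <= N)%N ->
  #|[pred X : 'M[R]_(m, k) | dvmx e X]| = (p ^ ((N - e) * (m * k)))%N.
Proof.
move=> eN; rewrite (card_mx_pred (fun _ _ => dv e)).
rewrite (eq_bigr (fun=> (p ^ (N - e)) ^ k)%N) => [|i _].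
  by rewrite prod_nat_const card_ord -!expnM [(k * m)%N]mulnC.
rewrite (eq_bigr (fun=> p ^ (N - e))%N) => [|j _]; last exact: card_dv.
by rewrite prod_nat_const card_ord.
Qed.

Lemma dvmx_scale m k d e (X : 'M[R]_(m, k)) : (d + e <= N)%N ->
  dvmx (d + e) (p%:R ^+ d *: X) = dvmx e X.
Proof.
move=> deN; apply: eq_forallb => i; apply: eq_forallb => j.
by rewrite mxE dvX.
Qed.

Definition content m k d (X : 'M[R]_(m, k)) := dvmx d X && ~~ dvmx d.+1 X.

(** Reduces sums over content [p ^ d] to primitive matrices. The fibre size stays as a factor on the
    right, so that no division of naturals occurs. *)
Lemma sum_content m k d (f : 'M[R]_(m, k) -> nat) : (d < N)%N ->
  (\sum_(X | content 0 X) f (p%:R ^+ d *: X)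
   = p ^ (d * (m * k)) * \sum_(X | content d X) f X)%N.
Proof.
move=> dN; rewrite big_mkcond /= [X in (_ * X)%N]big_mkcondr /=.
rewrite -(sum_dvmx (fun X => if ~~ dvmx d.+1 X then f X else 0%N)); last exact: ltnW.
apply: eq_bigr => X _; rewrite -[in RHS]addn1 dvmx_scale ?addn1 //.
by rewrite /content dvmx0.
Qed.

Lemma card_content m k d : (d < N)%N ->
  (#|[pred X : 'M[R]_(m, k) | content d X]| + p ^ ((N - d.+1) * (m * k))
   = p ^ ((N - d) * (m * k)))%N.
Proof.
move=> dN; rewrite -!card_dvmx ?(ltnW dN) // -[RHS](cardID [pred X | dvmx d.+1 X]) addnC.
congr (_ + _)%N; apply: eq_card => X; rewrite !inE //; last by rewrite andbC.
apply/idP/andP => [dX|[]//]; split=> //.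
by apply/dvmxP => i j; apply: dv_leq (dvmxP _ _ dX i j).
Qed.

(** * Solving the equations in [Y] for given [X] *)

Definition dot k (x y : V k) : R := \sum_j x 0 j * y 0 j.

Lemma dotDl k (x y z : V k) : dot (x + y) z = dot x z + dot y z.
Proof. by rewrite -big_split; apply: eq_bigr => l _; rewrite mxE mulrDl. Qed.

Lemma dotDr k (x y z : V k) : dot z (x + y) = dot z x + dot z y.
Proof. by rewrite -big_split; apply: eq_bigr => l _; rewrite mxE mulrDr. Qed.

Lemma dotZl k a (x z : V k) : dot (a *: x) z = a * dot x z.
Proof. by rewrite [RHS]big_distrr /=; apply: eq_bigr => l _; rewrite mxE mulrA. Qed.

Lemma dotZr k a (x z : V k) : dot z (a *: x) = a * dot z x.
Proof. by rewrite [RHS]big_distrr /=; apply: eq_bigr => l _; rewrite mxE mulrCA. Qed.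

(* Coordinates adapted to a primitive vector [v]: [A] writes [x] as
   [t v + w] with [w] supported off a coordinate where [v] is a unit, and [B] is
   the contragredient change of coordinates. *)
Lemma primitive_coordinates k (v : V k.+1) : content 0 v ->
  exists A B : R * V k -> V k.+1,
  [/\ bijective A, bijective B,
      forall t w s y, dot (A (t, w)) (B (s, y)) = t * s + dot w y,
      forall s y, dot v (B (s, y)) = s
    & forall t w e, (e <= N)%N -> dvmx e (A (t, w)) = dv e t && dvmx e w].
Proof.
case/andP=> _; rewrite negb_forall => /existsP[i]; rewrite negb_forall ord1 => /existsP[m vm].
have um := dv_unit vm => {vm i}.
pose r (x : V k.+1) : V k := \row_j x 0 (lift m j).
pose ins (x0 : R) (x : V k) : V k.+1 := \row_j oapp (x 0) x0 (unlift m j).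
have insm x0 x : ins x0 x 0 m = x0 by rewrite mxE unlift_none.
have insl x0 x j : ins x0 x 0 (lift m j) = x 0 j by rewrite mxE liftK.
have rins x0 x : r (ins x0 x) = x by apply/rowP => j; rewrite mxE insl.
have insr (x : V k.+1) : ins (x 0 m) (r x) = x.
  by apply/rowP => j; rewrite mxE; case: unliftP => [j'|] -> //=; rewrite mxE.
have dotE x0 x y0 y : dot (ins x0 x) (ins y0 y) = x0 * y0 + dot x y.
  by rewrite /dot (bigD1_ord m) //= !insm; congr +%R; apply: eq_bigr => j _; rewrite !insl.
have dotv x0 x : dot v (ins x0 x) = v 0 m * x0 + dot (r v) x.
  by rewrite -{1}(insr v) dotE.
pose A (tw : R * V k) := ins (tw.1 * v 0 m) (tw.1 *: r v + tw.2).
(* The coordinate [m] is the one that makes the pairing with [v] equal to the first component. *)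
pose B (sy : R * V k) := ins ((v 0 m)^-1 * (sy.1 - dot (r v) sy.2)) sy.2.
exists A, B; split.
- exists (fun x : V k.+1 => ((v 0 m)^-1 * x 0 m, r x - ((v 0 m)^-1 * x 0 m) *: r v)) => [[t w]|x].
    rewrite /A insm /= rins mulrC mulrK //; congr pair.
    by rewrite addrAC subrr add0r.
  by rewrite /A /= mulrC mulrA mulrV // mul1r addrC subrK insr.
- exists (fun y : V k.+1 => (dot v y, r y)) => [[s y]|y].
    by rewrite /B dotv rins mulrA mulrV // mul1r subrK.
  by rewrite /B /= -{1}(insr y) dotv addrK mulrA mulVr // mul1r insr.
- move=> t w s y; rewrite /A /B dotE /= dotDl dotZl.
  rewrite -mulrA [v 0 m * _]mulrA mulrV // mul1r; ring.
- by move=> s y; rewrite /B dotv mulrA mulrV // mul1r subrK.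
move=> t w e eN; apply/dvmxP/andP => [H|[dt /dvmxP dw] i j]; last first.
  rewrite ord1 /A mxE; case: unliftP => [j'|] _ /=; last exact: dvM.
  by rewrite !mxE; apply: dvD => //; exact: dvM.
have dt : dv e t.
  have -> : t = A (t, w) 0 m * (v 0 m)^-1 by rewrite /A insm /= mulrK.
  exact: dvM.
split=> //; apply/dvmxP => i j; rewrite ord1.
have := H 0 (lift m j); rewrite /A insl /= !mxE addrC dvDl //.
exact: dvM.
Qed.

Lemma sum_mulX e (m : R) : (e <= N)%N ->
  (\sum_(s : R) (p%:R ^+ e * s == m)%R = dv e m * p ^ e)%N.
Proof.
move=> eN; rewrite -card_mulX // -sum1_card [RHS]big_mkcond.
by apply: eq_bigr => s _; rewrite unfold_in /=; case: eqP.
Qed.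

Lemma sum_rV1 k : (\sum_(y : V k) 1 = p ^ (N * k))%N.
Proof.
by rewrite sum1_card card_mx mul1n card_ord Zp_cast ?pN_gt1 // -expnM.
Qed.

Lemma sum_dot_eq k (v : V k.+1) e (m : R) : content 0 v -> (e <= N)%N ->
  (\sum_(y : V k.+1) (p%:R ^+ e * dot v y == m)%R = dv e m * p ^ e * p ^ (N * k))%N.
Proof.
move=> vp eN; have [_ [B [_ /onW_bij bijB _ dotvB _]]] := primitive_coordinates vp.
rewrite (reindex B); last exact: bijB.
rewrite -(sum_mulX m eN) -sum_rV1 big_distrlr /= pair_bigA /=.
by apply: eq_bigr => -[s y] _; rewrite dotvB muln1.
Qed.

(** A vector [w] of content [p ^ d] is [p ^ d] times a primitive one, to which [sum_dot_eq] applies.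
    The sum stops at [D - i], since a [w] divisible by [p ^ (D + 1 - i)] would force [p ^ (D + 1)]
    to divide [m]. *)
Lemma sum_scaled_dot_eq k i e D (m : R) : (i + e <= D.+1)%N -> (D < N)%N -> ~~ dv D.+1 m ->
  (\sum_(w : V k.+1 | dvmx e w) \sum_(y : V k.+1) (p%:R ^+ i * dot w y == m)%R
   = \sum_(e <= d < D.+1 - i) #|[pred w : V k.+1 | content d w]|
       * (dv (i + d) m * p ^ (i + d) * p ^ (N * k)))%N.
Proof.
move=> ieD DN mD.
rewrite (@sum_filtration _ (fun d => @dvmx 1 k.+1 d) _ e (D.+1 - i)); last 2 first.
- by move=> d X /dvmxP dX; apply/dvmxP => a b; apply: dv_leq (dX a b).
- lia.
rewrite [X in (_ + X)%N]big1 ?addn0 => [|w /dvmxP dw]; last first.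
  apply: big1 => y _; apply/eqP; rewrite eqb0; apply: contraNN mD => /eqP <-.
  have -> : D.+1 = (i + (D.+1 - i))%N by lia.
  rewrite dvX; last by lia.
  rewrite /dot; elim/big_rec: _ => [|j x _ dx]; first by rewrite /dv dvdn0.
  by apply: dvD => //; [lia|apply: dvM => //; lia].
rewrite !big_nat; apply: eq_bigr => d /andP[ed dD].
have dN : (d < N)%N by lia.
(* Multiplying by the fibre size of [sum_content] allows the replacement of [w] by [p ^ d w] with
   [w] primitive. *)
apply/eqP; rewrite -(eqn_pmul2l (m := p ^ (d * (1 * k.+1)))) ?expn_gt0 ?prime_gt0 //.
have <- := @sum_content 1 k.+1 d (fun w => \sum_y (p%:R ^+ i * dot w y == m)%R)%N dN.
rewrite -sum1_card mulnA -(sum_content (fun=> 1%N)) // big_distrl /=; apply/eqP.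
apply: eq_bigr => w wp; rewrite mul1n -(sum_dot_eq m wp); last by lia.
by apply: eq_bigr => y _; rewrite dotZl mulrA exprD.
Qed.

(** The value of the form at [e2 - t e1], where [a], [b], [c] are [q(e1)], the polar form at
    [(e1, e2)], and [q(e2)]. If [x2 = t x1 + w], then [w] is the [X] part of the image of this
    vector. *)
Definition qval (a b c t : R) : R := c - t * b + t ^+ 2 * a.

Definition gram_eqs k i (a b c : R) (x1 x2 y1 y2 : V k) :=
  [&& p%:R ^+ i * dot x1 y1 == a, p%:R ^+ i * (dot x1 y2 + dot x2 y1) == b
    & p%:R ^+ i * dot x2 y2 == c].

(** Write [x2 = t x + w], and [y1], [y2] in the dual coordinates [(s1, z1)], [(s2, z2)]. After a
    triangular change of variables the equations determine [p ^ i s1], [p ^ i s2] and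
    [p ^ i dot w z2], while [z1] is free. *)
Lemma sum_gram_eqs_primitive k i e a b c (x : V k.+1) :
  content 0 x -> (i <= N)%N -> (e <= N)%N -> dv i a -> dv i b ->
  (\sum_(x2 : V k.+1 | dvmx e x2) \sum_(y1 : V k.+1) \sum_(y2 : V k.+1) gram_eqs i a b c x x2 y1 y2
   = p ^ (i + i) * p ^ (N * k) * \sum_(t | dv e t) \sum_(w : V k | dvmx e w) \sum_(y : V k)
       (p%:R ^+ i * dot w y == qval a b c t)%R)%N.
Proof.
move=> xp iN eN da db; have [A [B [bijA bijB dotAB dotxB dvA]]] := primitive_coordinates xp.
have sumA F : (\sum_(x2 : V k.+1 | dvmx e x2) F x2
    = \sum_(t | dv e t) \sum_(w : V k | dvmx e w) F (A (t, w)))%N.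
  rewrite (reindex A) ?pair_big /=; last exact: onW_bij.
  by apply: eq_big => -[t w] //=; rewrite dvA.
have sumB F : (\sum_(y : V k.+1) F y = \sum_s \sum_(z : V k) F (B (s, z)))%N.
  rewrite (reindex B) ?pair_big /=; last exact: onW_bij.
  by apply: eq_big => -[s z].
rewrite sumA big_distrr /=; apply: eq_bigr => t _.
rewrite big_distrr /=; apply: eq_bigr => w _.
rewrite sumB; under eq_bigr => s1 _ do under eq_bigr => z1 _ do rewrite sumB.
transitivity (\sum_(s1 : R) \sum_(z1 : V k) \sum_(s2 : R) \sum_(z2 : V k)
   ((p%:R ^+ i * s1 == a)%R * ((p%:R ^+ i * s2 == b)%R *
   (p%:R ^+ i * dot w z2 == qval a b c t)%R)))%N.
  apply: eq_bigr => s1 _; apply: eq_bigr => z1 _.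
  (* These two translations amount to replacing [y2] by [y2 - t y1] in the last equation and
     removing the mixed terms from the second. *)
  rewrite (reindex_inj (addIr (- (t * s1 + dot w z1)))) /=; apply: eq_bigr => s2 _.
  rewrite (reindex_inj (addIr (t *: z1))) /=; apply: eq_bigr => z2 _.
  rewrite -!mulnb /gram_eqs /qval !dotxB !dotAB dotDr dotZr.
  have -> : s2 - (t * s1 + dot w z1) + (t * s1 + dot w z1) = s2 by ring.
  have -> : t * (s2 - (t * s1 + dot w z1)) + (dot w z2 + t * dot w z1)
     = t * s2 - t ^+ 2 * s1 + dot w z2 by ring.
  case: eqP => [<-|//]; case: eqP => [<-|//] /=; rewrite !mul1n.
  set P := p%:R ^+ i; congr nat_of_bool; rewrite -subr_eq0 -[RHS]subr_eq0.
  by congr (_ == 0); ring.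
transitivity (\sum_(s1 : R) (p%:R ^+ i * s1 == a)%R * (p ^ (N * k) * (\sum_(s2 : R) (p%:R ^+ i * s2 == b)%R *
   (\sum_(y : V k) (p%:R ^+ i * dot w y == qval a b c t)%R))))%N.
  apply: eq_bigr => s1 _; rewrite -sum_rV1 big_distrl big_distrr /=; apply: eq_bigr => z1 _.
  rewrite mul1n big_distrr /=; apply: eq_bigr => s2 _.
  rewrite big_distrr big_distrr /=; apply: eq_bigr => z2 _ //.
rewrite -!big_distrl /= !sum_mulX // da db !mul1n expnD.
by rewrite !mulnA [(_ * p ^ i)%N in LHS]mulnAC.
Qed.

Lemma gram_eqsC k i a b c (x1 x2 y1 y2 : V k) :
  gram_eqs i a b c x1 x2 y1 y2 = gram_eqs i c b a x2 x1 y2 y1.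
Proof. by rewrite /gram_eqs [dot x2 y1 + _]addrC; case: eqP; case: eqP; case: eqP. Qed.

(** The number of [(t, w, y)] with [t] and [w] divisible by [p ^ e] and
    [p ^ i dot w y = qval a b c t], sorted by the content [p ^ d] of [w], when [p ^ (D + 1)] divides
    no such value of [qval]. *)
Definition chart_count k i e D a b c : nat :=
  (\sum_(e <= d < D.+1 - i) #|[pred w : V k.+1 | content d w]|
     * (#|[pred t | dv e t && dv (i + d) (qval a b c t)]| * p ^ (i + d) * p ^ (N * k)))%N.

Lemma sum_gram_eqs_isotropic k i e D a b c (x : V k.+2) :
  content 0 x -> (i + e <= D.+1)%N -> (D < N)%N -> dv i a -> dv i b ->
  (forall t, dv e t -> ~~ dv D.+1 (qval a b c t)) ->
  (\sum_(x2 : V k.+2 | dvmx e x2) \sum_(y1 : V k.+2) \sum_(y2 : V k.+2)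
     gram_eqs i a b c x x2 y1 y2
   = p ^ (i + i) * p ^ (N * k.+1) * chart_count k i e D a b c)%N.
Proof.
move=> xp ieD DN da db nD; rewrite sum_gram_eqs_primitive //; try lia.
congr (_ * _)%N; under eq_bigr => t dt do rewrite (sum_scaled_dot_eq k ieD DN (nD t dt)).
rewrite exchange_big /=; apply: eq_bigr => d _.
rewrite -big_distrr -!big_distrl /=; congr (_ * (_ * _ * _))%N.
rewrite -sum1_card.
rewrite [RHS](eq_bigl (fun t => dv e t && dv (i + d) (qval a b c t))) // [RHS]big_mkcondr /=.
by apply: eq_bigr => t _; case: dv.
Qed.

Lemma content0 m k (X : 'M[R]_(m, k)) : content 0 X = ~~ dvmx 1 X.
Proof. by rewrite /content dvmx0. Qed.

Lemma dvmx_col_mx k e (x1 x2 : V k) : dvmx e (col_mx x1 x2) = dvmx e x1 && dvmx e x2.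
Proof.
apply/dvmxP/andP => [H|[/dvmxP d1 /dvmxP d2] i j].
  split; apply/dvmxP => i j.
    by have := H (lshift 1 i) j; rewrite col_mxEu.
  by have := H (rshift 1 i) j; rewrite col_mxEd.
by rewrite mxE; case: splitP.
Qed.

Lemma sum_col_mx k (P : pred 'M[R]_(1 + 1, k)) (F : 'M[R]_(1 + 1, k) -> nat) :
  (\sum_(X | P X) F X
   = \sum_(x1 : V k) \sum_(x2 : V k | P (col_mx x1 x2)) F (col_mx x1 x2))%N.
Proof.
rewrite pair_big_dep /= (reindex (fun x : V k * V k => col_mx x.1 x.2)) //=.
exists (fun X => (usubmx X, dsubmx X)) => [[x1 x2]|X] _ /=.
  by rewrite col_mxKu col_mxKd.
exact: vsubmxK.
Qed.

Definition gram_count k i a b c (X : 'M[R]_(1 + 1, k)) : nat :=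
  (\sum_(y1 : V k) \sum_(y2 : V k) gram_eqs i a b c (usubmx X) (dsubmx X) y1 y2)%N.

(* The two terms run over the charts [x1] primitive, [x2 = t x1 + w] and
   [x2] primitive, [x1 = t x2 + w] with [t] and [w] divisible by [p]. *)
Lemma sum_gram_count_primitive k i D a b c :
  (i <= D)%N -> (D < N)%N -> dv i a -> dv i b -> dv i c ->
  (forall t, ~~ dv D.+1 (qval a b c t)) ->
  (forall t, dv 1 t -> ~~ dv D.+1 (qval c b a t)) ->
  (\sum_(X : 'M[R]_(1 + 1, k.+2) | content 0 X) gram_count i a b c X
   = #|[pred x : V k.+2 | content 0 x]| * (p ^ (i + i) * p ^ (N * k.+1) *
      (chart_count k i 0 D a b c + chart_count k i 1 D c b a)))%N.
Proof.
move=> iD DN da db dc n1 n2; rewrite sum_col_mx.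
transitivity (\sum_(x1 : V k.+2) \sum_(x2 : V k.+2 | ~~ (dvmx 1 x1 && dvmx 1 x2))
   \sum_(y1 : V k.+2) \sum_(y2 : V k.+2) gram_eqs i a b c x1 x2 y1 y2)%N.
  apply: eq_bigr => x1 _; apply: eq_big => [x2|x2 _]; first by rewrite content0 dvmx_col_mx.
  by rewrite /gram_count col_mxKu col_mxKd.
rewrite (bigID (fun x1 : V k.+2 => content 0 x1)) /= !mulnDr; congr (_ + _)%N.
  rewrite -sum1_card big_distrl /=; apply: eq_bigr => x xp; rewrite mul1n.
  rewrite -[RHS](@sum_gram_eqs_isotropic k i 0 D a b c x) ?addn0 ?(leqW iD) //.
  apply: eq_bigl => x2; move: xp; rewrite content0 => /negbTE ->.
  by rewrite dvmx0.
(* If [p] divides [x1], then [x2] is primitive; the rows, and with them [a] and [c], exchange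
   roles. *)
rewrite (eq_bigl (dvmx 1)) => [|x]; last by rewrite content0 negbK.
under eq_bigr => x1 -> do rewrite /=.
rewrite (exchange_big_dep (fun x2 : V k.+2 => content 0 x2)) /=; last first.
  by move=> x1 x2 _; rewrite content0.
rewrite -sum1_card big_distrl /=; apply: eq_bigr => x xp; rewrite mul1n.
rewrite -[RHS](@sum_gram_eqs_isotropic k i 1 D c b a x) ?addn1 ?ltnS //.
under [RHS]eq_bigr => x2 _ do rewrite exchange_big.
apply: eq_big => [x1|x1 _]; first by rewrite -content0 xp andbT.
by apply: eq_bigr => y1 _; apply: eq_bigr => y2 _; rewrite gram_eqsC.
Qed.

(** The sum over contents is finite because an [X] divisible by [p ^ (e + 1)] would make
    [a = dot x1 y1] divisible by it too. *)
Lemma sum_gram_count k a b c e :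
  (e < N)%N -> ~~ dv e.+1 a ->
  (\sum_(X : 'M[R]_(1 + 1, k)) gram_count 0 a b c X
   = \sum_(0 <= i < e.+1) \sum_(X : 'M[R]_(1 + 1, k) | content i X) gram_count 0 a b c X)%N.
Proof.
move=> eN nda; rewrite (eq_bigl (fun X => dvmx 0 X)) => [|X]; last by rewrite dvmx0.
rewrite (@sum_filtration _ (fun d => @dvmx (1 + 1) k d) _ 0 e.+1); last 2 first.
- by move=> d X /dvmxP dX; apply/dvmxP => i j; apply: dv_leq (dX i j).
- by [].
rewrite [X in (_ + X)%N]big1 ?addn0 // => X /dvmxP dX.
apply: big1 => y1 _; apply: big1 => y2 _; apply/eqP; rewrite eqb0.
apply: contraNN nda => /and3P[/eqP <- _ _]; rewrite mul1r.
rewrite /dot; elim/big_rec: _ => [|j x _ dx]; first by rewrite /dv dvdn0.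
by apply: dvD => //; rewrite mxE; apply: dvM.
Qed.

Lemma sum_gram_count_content k i a b c : (i < N)%N ->
  (p ^ (i * (2 * k)) * \sum_(X : 'M[R]_(1 + 1, k) | content i X) gram_count 0 a b c X
   = \sum_(X : 'M[R]_(1 + 1, k) | content 0 X) gram_count i a b c X)%N.
Proof.
move=> iN; rewrite -sum_content //; apply: eq_bigr => X _.
apply: eq_bigr => y1 _; apply: eq_bigr => y2 _; rewrite /gram_eqs !linearZ /=.
by rewrite !dotZl -mulrDr !expr0 !mul1r.
Qed.

End ResidueRing.

(** * Diagonal orders *)

Section NormalForm.
Context (p : nat) (p_pr : prime p).
Local Notation Zp := (padic_int p_pr).
Implicit Types (a b c t x : Zp) (e j m : nat).

(** The conditions of [S(B)] for the form [a x^2 + b x y + c y^2]; as [b] is twice the off-diagonal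
    Gram entry, the bound [(a1 + a2) / 2] is rounded up. *)
Definition admissible_coefs a b c (a1 a2 : nat) :=
  [&& (a1 <= a2)%N, pdvd a1 a, pdvd a2 c & pdvd (uphalf (a1 + a2)) b].

(** The order is [min(h, 2 ord x)]: below [h] the square term dominates, and the nonvanishing
    hypothesis excludes cancellation at order [h] when [h] is even. *)
Lemma pdvd_diag A B C h x m : ~~ pdvd 1 A -> ~~ pdvd 1 C ->
  (~~ odd h -> forall y, ~~ pdvd 1 (A * y ^+ 2 + B * y + C)) ->
  pdvd m (A * x ^+ 2 + p%:R ^+ uphalf h * B * x + p%:R ^+ h * C)
  = (m <= h)%N && pdvd (uphalf m) x.
Proof.
move=> nA nC nq; set g := _ + p%:R ^+ h * C.
(* As long as [2 ord x < h], the linear and constant terms have larger order than [A x^2]. *)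
have stepx k : (k.*2.-1 <= h)%N -> pdvd k.*2.-1 g -> pdvd k x.
  elim: k => [|k IHk] kh dg; first by rewrite pdvd0.
  have /pdvdP[y xE] : pdvd k x by apply: IHk; [lia|apply: pdvd_leq dg; lia].
  have hE : p%:R ^+ h = p%:R ^+ k.*2 * p%:R * p%:R ^+ (h - k.*2.+1) :> Zp.
    by rewrite -mulrA -exprS -exprD; congr (_ ^+ _); lia.
  have uE : p%:R ^+ uphalf h = p%:R ^+ k * p%:R * p%:R ^+ (uphalf h - k.+1) :> Zp.
    by rewrite -mulrA -exprS -exprD; congr (_ ^+ _); lia.
  have gE : g = p%:R ^+ k.*2 * (A * (y * y) + p%:R * (p%:R ^+ (uphalf h - k.+1) * B * y
     + p%:R ^+ (h - k.*2.+1) * C)).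
    by rewrite /g hE uE xE -addnn exprD; ring.
  have : pdvd 1 (A * (y * y)).
    rewrite -(@pdvdDl _ _ _ _ (p%:R * (p%:R ^+ (uphalf h - k.+1) * B * y
     + p%:R ^+ (h - k.*2.+1) * C))); last by apply/pdvdP; eexists; rewrite expr1.
    by rewrite -(pdvdX k.*2) -gE; apply: pdvd_leq dg; lia.
  rewrite !pdvd1M (negbTE nA) orbb /= => dy.
  by rewrite xE -addn1 pdvdX.
apply/idP/andP => [dg|[mh /pdvdP[y xE]]]; last first.
  have hE : p%:R ^+ h = p%:R ^+ m * p%:R ^+ (h - m) :> Zp.
    by rewrite -exprD; congr (_ ^+ _); lia.
  have u2E : p%:R ^+ uphalf m * p%:R ^+ uphalf m = p%:R ^+ m * p%:R ^+ (odd m) :> Zp.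
    by rewrite -!exprD; congr (_ ^+ _); lia.
  have uE : p%:R ^+ uphalf h * p%:R ^+ uphalf m = p%:R ^+ m * p%:R ^+ (uphalf h + uphalf m - m) :> Zp.
    by rewrite -!exprD; congr (_ ^+ _); lia.
  apply/pdvdP; exists (A * p%:R ^+ odd m * y ^+ 2 + p%:R ^+ (uphalf h + uphalf m - m) * B * y + p%:R ^+ (h - m) * C).
  rewrite /g xE hE.
  transitivity (A * (p%:R ^+ uphalf m * p%:R ^+ uphalf m) * y ^+ 2
    + (p%:R ^+ uphalf h * p%:R ^+ uphalf m) * B * y + p%:R ^+ m * p%:R ^+ (h - m) * C); first by ring.
  by rewrite u2E uE; ring.
have mh : (m <= h)%N.
  rewrite leqNgt; apply/negP => hm.
  have /pdvdP[y xE] : pdvd h./2 x by apply: stepx; [lia|apply: pdvd_leq dg; lia].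
  have {dg} dg : pdvd h.+1 g by apply: pdvd_leq dg.
  (* For odd [h], divisibility by [p ^ (h + 1)] forces [p] to divide [y], which leaves [p ^ h C] as
     the only term of order [h]. For even [h], it gives a zero of the reduced form. *)
  have hE := odd_double_half h; case: (boolP (odd h)) => oh.
    move: dg; have -> : g = p%:R ^+ h./2.*2 * (A * y ^+ 2 + p%:R * (B * y + C)).
      have -> : p%:R ^+ h./2.*2 = p%:R ^+ h./2 * p%:R ^+ h./2 :> Zp by rewrite -exprD addnn.
      have e1 : p%:R ^+ h = p%:R ^+ h./2 * p%:R ^+ h./2 * p%:R :> Zp.
        by rewrite -!exprD -exprSr; congr (_ ^+ _); lia.
      have e2 : p%:R ^+ uphalf h = p%:R ^+ h./2 * p%:R :> Zp.
        by rewrite -exprSr; congr (_ ^+ _); lia.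
      by rewrite /g e1 e2 xE; ring.
    have -> : h.+1 = (h./2.*2 + 2)%N by lia.
    rewrite pdvdX => dg.
    have : pdvd 1 (A * (y * y)).
      rewrite -(@pdvdDl _ _ _ _ (p%:R * (B * y + C))); first exact: pdvd_leq dg.
      by apply/pdvdP; eexists; rewrite expr1.
    rewrite !pdvd1M (negbTE nA) orbb => /pdvdP[z yE].
    have dC : pdvd 2 (p%:R * (B * y + C)).
      rewrite -(@pdvdDl _ _ _ _ (A * y ^+ 2)) 1?addrC //.
      by apply/pdvdP; exists (A * z ^+ 2); rewrite yE; ring.
    move: dC; rewrite -[p%:R]expr1 (pdvdX 1 1) addrC pdvdDl ?(negbTE nC) //.
    by apply/pdvdP; exists (B * z); rewrite yE; ring.
  move: dg; have -> : g = p%:R ^+ h * (A * y ^+ 2 + B * y + C).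
    have e1 : p%:R ^+ h = p%:R ^+ h./2 * p%:R ^+ h./2 :> Zp.
      by rewrite -!exprD; congr (_ ^+ _); lia.
    have e2 : uphalf h = h./2 by lia.
    by rewrite /g e1 e2 xE; ring.
  by rewrite -addn1 pdvdX; apply/negP; apply: nq.
split=> //; apply: stepx; last apply: pdvd_leq dg; lia.
Qed.

(** On the chart [e2 - t e1] the order is [min(a2, a1 + 2 ord t)]; on the chart [e1 - t e2] with [p]
    dividing [t] it is [a1]. *)
Definition diagonal_orders a b c (a1 a2 : nat) :=
  [/\ pdvd a1 a, pdvd a1 b, pdvd a1 c,
      forall t j, pdvd j (c - t * b + t ^+ 2 * a) = (j <= a2)%N && pdvd (uphalf (j - a1)) t
    & forall t j, pdvd 1 t -> pdvd j (a - t * b + t ^+ 2 * c) = (j <= a1)%N].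

Lemma pdvd_sub (a1 j : nat) g : pdvd j (p%:R ^+ a1 * g : Zp) = pdvd (j - a1) g.
Proof.
have [ja|/ltnW aj] := leqP j a1; last by rewrite -{1}(subnKC aj) pdvdX.
have -> : (j - a1 = 0)%N by lia.
rewrite pdvd0; apply: (@pdvd_leq _ _ _ (a1 + 0)); first by lia.
by rewrite pdvdX pdvd0.
Qed.

(* [S] stands for the coefficients of the form in the various bases. *)
Lemma exists_diagonal_orders (S : Zp -> Zp -> Zp -> Prop) (a1 a2 : nat) :
  (forall a b c t, S a b c -> S a (b + 2%:R * a * t) (a * t ^+ 2 + b * t + c)) ->
  (forall a b c, S a b c -> S c b a) ->
  (forall a b c t, S a b c -> a * t ^+ 2 + b * t + c <> 0) ->
  (forall a b c (b1 b2 : nat), S a b c -> admissible_coefs a b c b1 b2 ->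
     (b1 < a1)%N || (b1 == a1) && (b2 <= a2)%N) ->
  (exists a b c, S a b c /\ admissible_coefs a b c a1 a2) ->
  exists a b c, S a b c /\ diagonal_orders a b c a1 a2.
Proof.
have uphalf_even : (a1 <= a2)%N -> ~~ odd (a2 - a1) ->
    uphalf (a1 + a2.+1) = (uphalf (a1 + a2) + 1)%N by lia.
have uphalf_odd : (a1 <= a2)%N -> odd (a2 - a1) ->
    uphalf (a1 + a2.+1) = uphalf (a1 + a2) by lia.
move=> shiftS swapS anisoS maxS [a0 [b0 [c0 [S0 adm0]]]].
have [a [b [c [Sabc /and4P[le12 da dc db] nda]]]] : exists a b c,
    [/\ S a b c, admissible_coefs a b c a1 a2 & ~~ pdvd a1.+1 a].
  have [da|nda] := boolP (pdvd a1.+1 a0); last by exists a0, b0, c0.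
  have [le12 da1 dc db] := and4P adm0.
  have [e12|lt12] : a1 = a2 \/ (a1 < a2)%N by lia.
    have uE : uphalf (a1 + a2) = a1 by lia.
    rewrite uE in db; subst a2.
    have [dc1|ndc] := boolP (pdvd a1.+1 c0); last first.
      exists c0, b0, a0; split=> //; first exact: swapS.
      by rewrite /admissible_coefs uE leqnn dc db da1.
    have [db1|ndb] := boolP (pdvd a1.+1 b0).
      have := maxS _ _ _ a1.+1 a1.+1 S0; rewrite /admissible_coefs leqnn da dc1.
      have -> : uphalf (a1.+1 + a1.+1) = a1.+1 by lia.
      by rewrite db1 => /(_ isT); lia.
    (* Here [b] alone has order exactly [a1], so the sum of the two basis vectors has value of order
       [a1]. *)
    have S1 := shiftS _ _ _ 1 (swapS _ _ _ S0).
    exists (c0 * 1 ^+ 2 + b0 * 1 + a0), (b0 + 2%:R * c0 * 1), c0; split.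
    - exact: swapS.
    - rewrite /admissible_coefs uE leqnn dc !mulr1 ?expr1n ?mulr1 /=.
      apply/andP; split; first by rewrite !pdvdD.
      by rewrite pdvdD // mulrC pdvdM.
    rewrite expr1n !mulr1 pdvdDl // addrC pdvdDl //.
  have /(maxS _ _ _ _ _ S0) : admissible_coefs a0 b0 c0 a1.+1 a1.+1.
    by rewrite /admissible_coefs leqnn da (pdvd_leq lt12 dc) (pdvd_leq _ db) //; lia.
  by lia.
have [A aE] := pdvdP _ _ da; have [C cE] := pdvdP _ _ dc; have [B bE] := pdvdP _ _ db.
set h := (a2 - a1)%N.
have a2E : p%:R ^+ a2 = p%:R ^+ a1 * p%:R ^+ h :> Zp by rewrite -exprD subnKC.
have uE : p%:R ^+ uphalf (a1 + a2) = p%:R ^+ a1 * p%:R ^+ uphalf h :> Zp.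
  by rewrite -exprD; congr (_ ^+ _); lia.
have nA : ~~ pdvd 1 A by apply: contraNN nda => dA; rewrite aE -addn1 pdvdX.
(* A simple zero modulo [p] lifts by Hensel to an isotropic vector. At a double zero, shifting the
   second basis vector makes [(a1, a2 + 1)] admissible, against maximality. *)
have nq : ~~ odd h -> forall y, ~~ pdvd 1 (A * y ^+ 2 + B * y + C).
  move=> oh y; apply/negP => dq.
  have hE : uphalf h = h./2 by lia.
  have p2E : p%:R ^+ h = p%:R ^+ h./2 * p%:R ^+ h./2 :> Zp.
    by rewrite -exprD; congr (_ ^+ _); lia.
  have [dD|ndD] := boolP (pdvd 1 (2%:R * A * y + B)); last first.
    have [s sE] := hensel_quadratic dq ndD.
    apply: (anisoS _ _ _ (s * p%:R ^+ h./2) Sabc).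
    transitivity (p%:R ^+ a2 * (A * s ^+ 2 + B * s + C)); last by rewrite sE mulr0.
    by rewrite cE aE bE uE a2E hE p2E; ring.
  have S1 := shiftS _ _ _ (y * p%:R ^+ h./2) Sabc.
  suff /(maxS _ _ _ a1 a2.+1 S1) : admissible_coefs a (b + 2%:R * a * (y * p%:R ^+ h./2))
      (a * (y * p%:R ^+ h./2) ^+ 2 + b * (y * p%:R ^+ h./2) + c) a1 a2.+1.
    by rewrite ltnn eqxx ltnn.
  apply/and4P; split=> //; first exact: leqW.
    have -> : a * (y * p%:R ^+ h./2) ^+ 2 + b * (y * p%:R ^+ h./2) + c
       = p%:R ^+ a2 * (A * y ^+ 2 + B * y + C).
      by rewrite cE aE bE uE a2E hE p2E; ring.
    by rewrite -addn1 pdvdX.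
  have -> : b + 2%:R * a * (y * p%:R ^+ h./2) = p%:R ^+ (uphalf (a1 + a2)) * (2%:R * A * y + B).
    by rewrite bE uE aE hE; ring.
  by rewrite uphalf_even // pdvdX.
(* For odd [h] the bound on [b] is the same for [a2] and [a2 + 1], so [p] dividing [C] would
   contradict maximality; for even [h], take [y = 0] in [nq]. *)
have nC : ~~ pdvd 1 C.
  have [oh|eh] := boolP (odd h); last first.
    by have := nq eh 0; rewrite expr2 !mulr0 !add0r.
  apply/negP => dC.
  suff /(maxS _ _ _ a1 a2.+1 Sabc) : admissible_coefs a b c a1 a2.+1.
    by rewrite ltnn eqxx ltnn.
  apply/and4P; split=> //; first exact: leqW.
    by rewrite cE -addn1 pdvdX.
  by rewrite uphalf_odd.
exists a, b, c; split=> //; split=> //.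
- by apply: pdvd_leq db; lia.
- exact: pdvd_leq dc.
- move=> t j.
  have -> : c - t * b + t ^+ 2 * a = p%:R ^+ a1 * (A * t ^+ 2 + p%:R ^+ uphalf h * (- B) * t + p%:R ^+ h * C).
    by rewrite cE aE bE uE a2E; ring.
  rewrite pdvd_sub pdvd_diag //; last first.
    by move=> oh y; have := nq oh (- y); rewrite sqrrN mulrN mulNr.
  by congr (_ && _); lia.
move=> t j /pdvdP[s tE].
have -> : a - t * b + t ^+ 2 * c = p%:R ^+ a1 * (A + p%:R * (p%:R * p%:R ^+ h * s ^+ 2 * C - s * p%:R ^+ uphalf h * B)).
  by rewrite cE aE bE uE a2E tE; ring.
rewrite pdvd_sub; have [ja|aj] := leqP j a1.
  have -> : (j - a1 = 0)%N by lia.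
  exact: pdvd0.
apply: contraNF nA => dj; rewrite -(@pdvdDl _ _ _ _ (p%:R * (p%:R * p%:R ^+ h * s ^+ 2 * C - s * p%:R ^+ uphalf h * B))).
  by apply: pdvd_leq dj; lia.
by apply/pdvdP; eexists; rewrite expr1.
Qed.

End NormalForm.

(** * The Siegel polynomial *)

Section SiegelPolynomial.
Context (F : numFieldType) (p : nat) (p_pr : prime p) (a1 a2 : nat).
Context (a12 : (a1 <= a2)%N).
Local Notation P := (p%:R : F).

(* Points (t : 1), for [e = 0], and (1 : t) with [p | t], for [e = 1], at which
   the form is divisible by [p ^ (i + d)]: nu(i, d) is [p ^ d] times the sum of the
   two densities, the second one only for [d > 0]. *)
Definition chart_density e i d : F :=
  if e == 0%N then P ^- uphalf (i + d - a1) else (i + d <= a1)%N%:R / P.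

Definition chart_sum e i : {poly F} :=
  \sum_(e <= d < a2.+1 - i) (P ^+ (3 * i + 2 * d) * chart_density e i d) *: 'X^(2 * i + d).

Definition siegel_poly : {poly F} :=
  (1 - 'X) * (1 - P *: 'X) * \sum_(0 <= i < a1.+1) (chart_sum 0 i + chart_sum 1 i).

Let P_neq0 : P != 0. Proof. by rewrite pnatr_eq0 -lt0n prime_gt0. Qed.

(** Only the derivative [-p] of [1 - p X] survives at [1/p]; with [1 - 1/p] it gives [-(p - 1)], and
    each [p^(3i+2d) X^(2i+d)] becomes [p^(i+d)]. *)
Lemma deriv_siegel_poly :
  (siegel_poly^`()).[P^-1] = - (P - 1) *
    \sum_(0 <= i < a1.+1) (\sum_(0 <= d < a2.+1 - i) P ^+ (i + d) * chart_density 0 i d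
      + \sum_(1 <= d < a2.+1 - i) P ^+ (i + d) * chart_density 1 i d).
Proof.
rewrite /siegel_poly; set G := \sum_(0 <= i < a1.+1) (chart_sum 0 i + _).
have root_factor : (1 - P *: 'X).[P^-1] = 0 by rewrite !hornerE mulfV ?subrr.
have deriv_factor : (1 - P *: 'X)^`() = (- P)%:P.
  by rewrite derivB derivZ derivX derivC sub0r -mul_polyC mulr1 polyCN.
rewrite mulrAC derivM hornerD !hornerM root_factor mulr0 add0r deriv_factor hornerC.
have -> : (1 - 'X).[P^-1] = 1 - P^-1 by rewrite !hornerE.
have -> : G.[P^-1] = \sum_(0 <= i < a1.+1) (\sum_(0 <= d < a2.+1 - i) P ^+ (i + d) * chart_density 0 i d
      + \sum_(1 <= d < a2.+1 - i) P ^+ (i + d) * chart_density 1 i d).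
  rewrite horner_sum; apply: eq_bigr => i _; rewrite hornerD !horner_sum.
  have PE d : P ^+ (3 * i + 2 * d) = P ^+ (i + d) * P ^+ (2 * i + d).
    by rewrite -exprD; congr (_ ^+ _); lia.
  by congr (_ + _); apply: eq_bigr => d _;
    rewrite hornerZ hornerXn PE exprVn mulrAC mulfK // expf_neq0.
by rewrite mulrC mulrA; congr (_ * _); field; exact: P_neq0.
Qed.

(** One chain of the rectangle against the terms of content [p ^ i]. With [j = i + d], the first
    chart gives [p ^ j] for [j <= a1] and [p ^ ((a1 + j) / 2)], rounded down, beyond; the second
    chart repeats [p ^ j] for [j < a1]. *)
Lemma sum_half_powers i : (i <= a1)%N ->
  (\sum_(i.*2 <= l < (a1 + a2).+1) p ^ l./2)%N%:R
  = \sum_(0 <= d < a2.+1 - i) P ^+ (i + d) * chart_density 0 i d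
      + \sum_(1 <= d < a2.+1 - i) P ^+ (i + d) * chart_density 1 i d.
Proof.
move=> ia1; rewrite natr_sum (eq_bigr (fun l => P ^+ l./2)) => [|l _]; last by rewrite natrX.
have s0 : \sum_(0 <= d < a2.+1 - i) P ^+ (i + d) * chart_density 0 i d
   = \sum_(i <= j < a2.+1) P ^+ j / P ^+ uphalf (j - a1).
  rewrite -[in RHS](add0n i) big_addn; apply: eq_bigr => d _.
  by rewrite /chart_density /= addnC.
have s1 : \sum_(1 <= d < a2.+1 - i) P ^+ (i + d) * chart_density 1 i d
   = \sum_(i <= j < a1) P ^+ j.
  (* Shifting [d] by one absorbs the factor [1/p] of the second chart. *)
  rewrite -[in RHS](add0n i) big_addn big_add1 /=.
  rewrite (big_cat_nat (n := a1 - i)) //=; last by lia.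
  rewrite [X in _ + X]big1_seq ?addr0 => [|d].
    rewrite !big_nat; apply: eq_bigr => d dP; rewrite /chart_density /=.
    have -> : (i + d.+1 <= a1)%N by lia.
    by rewrite mul1r addnS exprSr mulfK // addnC.
  rewrite mem_index_iota => /andP[_ dP]; rewrite /chart_density /=.
  have -> : (i + d.+1 <= a1)%N = false by lia.
  by rewrite mul0r mulr0.
(* Cut at [l = 2 a1]: up to there both charts together give the pairs [2j], [2j + 1]; above,
   [l = j + a1] with [j > a1]. *)
rewrite s0 s1 (big_cat_nat (n := a1.*2.+1)) /=; try lia.
rewrite [X in _ = X + _](big_cat_nat (n := a1.+1)) /=; try lia.
rewrite [RHS]addrAC; congr (_ + _).
  rewrite [X in _ = X + _](eq_big_nat _ _ (F2 := fun j => P ^+ j)); last first.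
    move=> j jP; have -> : uphalf (j - a1) = 0%N by lia.
    by rewrite divr1.
  rewrite -(subnKC ia1); elim: (a1 - i)%N => [|m IHm].
    by rewrite addn0 !big_nat1 doubleK big_geq // addr0.
  have -> : ((i + m.+1).*2.+1 = (i + m).*2.+1.+2)%N by lia.
  rewrite [LHS]big_nat_recr; last by lia.
  rewrite [X in X + _ = _]big_nat_recr; last by lia.
  rewrite IHm addnS [\sum_(i <= _ < (i + m).+2) _]big_nat_recr; last by lia.
  rewrite [X in _ = _ + X]big_nat_recr; last by lia.
  have -> : ((i + m).*2.+1)./2 = (i + m)%N by lia.
  have -> : ((i + m).*2.+2)./2 = (i + m).+1 by lia.
  by rewrite /=; ring.
have -> : a1.*2.+1 = (a1.+1 + a1)%N by lia.
have -> : (a1 + a2).+1 = (a2.+1 + a1)%N by lia.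
rewrite big_addn addnK !big_nat; apply: eq_bigr => j jP.
have jE : P ^+ j = P ^+ (j + a1)./2 * P ^+ uphalf (j - a1).
  by rewrite -exprD; congr (_ ^+ _); lia.
by rewrite jE mulfK // expf_neq0.
Qed.
End SiegelPolynomial.


(** * The count modulo [p ^ N] as a value of the Siegel polynomial *)

Section Density.
Context (F : numFieldType) (p : nat) (p_pr : prime p) (n : nat).
Local Notation N := n.+1.
Local Notation R := 'Z_(p ^ N).
Local Notation P := (p%:R : F).

Let P_neq0 : P != 0. Proof. by rewrite pnatr_eq0 -lt0n prime_gt0. Qed.

Lemma natr_card_content k d : (d < N)%N ->
  #|[pred w : 'rV[R]_k | content d w]|%:R = P ^+ (N * k) * P ^- k ^+ d * (1 - P ^- k).
Proof.
move=> dN; have /(congr1 (fun m => m%:R : F)) := card_content p_pr 1 k dN.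
rewrite natrD !natrX mul1n => /(canRL (addrK _)) ->.
have powE e : (e <= N)%N -> P ^+ ((N - e) * k) = P ^+ (N * k) * P ^- k ^+ e.
  move=> eN; rewrite exprVn -exprM; apply: (canRL (mulfK _)); first by rewrite expf_neq0.
  by rewrite -exprD; congr (_ ^+ _); nia.
rewrite !powE ?(ltnW dN) //.
by rewrite exprSr; ring.
Qed.

Context (a1 a2 : nat) (a b c : R) (le12 : (a1 <= a2)%N) (a2N : (a2 < N)%N).
Context (da : dv a1 a) (db : dv a1 b) (dc : dv a1 c).
Context (dv_chart0 : forall t j, (j <= N)%N ->
  dv j (qval a b c t) = (j <= a2)%N && dv (uphalf (j - a1)) t).
Context (dv_chart1 : forall t j, (j <= N)%N -> dv 1 t ->
  dv j (qval c b a t) = (j <= a1)%N).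

Lemma natr_card_chart0 j : (j <= a2)%N ->
  #|[pred t | dv 0 t && dv j (qval a b c t)]|%:R = P ^+ N / P ^+ uphalf (j - a1).
Proof.
move=> ja; have uN : (uphalf (j - a1) <= N)%N by lia.
rewrite (eq_card (B := [pred t | dv (uphalf (j - a1)) t])) => [|t]; last first.
  by rewrite !inE dv0 dv_chart0 ?ja //; lia.
by rewrite card_dv // natrX -expfB_cond ?(negbTE P_neq0) ?add0n.
Qed.

Lemma natr_card_chart1 j : (j <= a2)%N ->
  #|[pred t | dv 1 t && dv j (qval c b a t)]|%:R = P ^+ N * ((j <= a1)%N%:R / P).
Proof.
move=> ja; have [ja1|ja1] := boolP (j <= a1)%N; last first.
  rewrite mul0r mulr0 eq_card0 // => t; rewrite !inE.
  by case: (boolP (dv 1 t)) => // dt; rewrite dv_chart1 // ?(negbTE ja1) //; lia.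
rewrite (eq_card (B := [pred t | dv 1 t])) => [|t]; last first.
  rewrite !inE; case: (boolP (dv 1 t)) => // dt; rewrite dv_chart1 ?ja1 //; lia.
by rewrite card_dv // natrX subn1 exprS mul1r mulrAC mulfV // mul1r.
Qed.

(** With [X = p ^ -(k + 2)], the vectors [w] of length [k + 1] have density [(p X)^d (1 - p X)] at
    content [p ^ d]; this is the source of the factor [1 - p X]. The power [X^(2i)] is the inverse
    of the fibre size of multiplication by [p ^ i] on 2 x (k + 2) matrices. *)
Lemma natr_chart_count k i e (a' b' c' : R) :
  (forall j, (j <= a2)%N ->
     #|[pred t | dv e t && dv j (qval a' b' c' t)]|%:R
       = P ^+ N * chart_density F p a1 e 0 j) ->
  (i <= a1)%N ->
  (chart_count k i e a2 a' b' c')%:R * P ^+ (i + i) * P ^- k.+2 ^+ (2 * i)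
  = P ^+ (N * (2 * k + 2)) * (1 - P * P ^- k.+2) * (chart_sum F p a1 a2 e i).[P ^- k.+2].
Proof.
move=> cardE ia1; rewrite /chart_count /chart_sum horner_sum natr_sum !mulr_suml mulr_sumr.
apply: eq_big_nat => d dP; rewrite !natrM natr_card_content; last by lia.
have XE : P ^- k.+1 = P * P ^- k.+2.
  by rewrite [in RHS]exprS invfM mulrA mulfV // mul1r.
rewrite cardE; last by lia.
have -> : chart_density F p a1 e i d = chart_density F p a1 e 0 (i + d) by [].
rewrite XE hornerZ hornerXn !natrX.
have -> : P ^+ (N * (2 * k + 2)) = P ^+ (N * k.+1) * P ^+ N * P ^+ (N * k).
  by rewrite -!exprD; congr (_ ^+ _); lia.
have -> : P ^+ (3 * i + 2 * d) = P ^+ (i + i) * P ^+ (i + d) * P ^+ d.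
  by rewrite -!exprD; congr (_ ^+ _); lia.
rewrite [_ ^+ (2 * i + d)]exprD [(P * _) ^+ d]exprMn; ring.
Qed.

(** The primitive row contributes [1 - X], and the two charts supply the rest. The exponent [4k + 5]
    is [2 (k + 2) n - n (n + 1) / 2] for [n = 2]; the equality is exact at every level [N > a2]. *)
Lemma natr_sum_gram_count k :
  (\sum_(X : 'M[R]_(1 + 1, k.+2)) gram_count 0 a b c X)%N%:R
  = P ^+ (N * (4 * k + 5)) * (siegel_poly F p a1 a2).[P ^- k.+2].
Proof.
(* At [t = 0] the second chart shows that [a] has order exactly [a1], which bounds the content by
   [a1]. *)
have q0 : qval c b a 0 = a by rewrite /qval mul0r expr0n mul0r subr0 addr0.
have dv10 : dv 1 (0 : R) by rewrite /dv dvdn0.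
rewrite (@sum_gram_count p p_pr n k.+2 a b c a1); last 2 first.
- by lia.
- by rewrite -q0 dv_chart1 //; lia.
rewrite natr_sum /siegel_poly !hornerM horner_sum !mulr_sumr.
have -> : (1 - 'X).[P ^- k.+2] = 1 - P ^- k.+2 by rewrite !hornerE.
have -> : (1 - P *: 'X).[P ^- k.+2] = 1 - P * P ^- k.+2 by rewrite !hornerE.
have nd0 t : ~~ dv a2.+1 (qval a b c t) by rewrite dv_chart0 ?ltnn.
have nd1 t : dv 1 t -> ~~ dv a2.+1 (qval c b a t).
  by move=> dt; rewrite dv_chart1 // -ltnNge ltnS.
apply: eq_big_nat => i /andP[_ ia1]; rewrite ltnS in ia1.
have iN : (i < N)%N by apply: leq_ltn_trans (leq_trans ia1 le12) a2N.
have /(congr1 (fun m => m%:R : F)) := sum_gram_count_content p_pr k.+2 a b c iN.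
rewrite (@sum_gram_count_primitive p p_pr n k i a2 a b c (leq_trans ia1 le12) a2N
  (dv_leq ia1 da) (dv_leq ia1 db) (dv_leq ia1 dc) nd0 nd1).
rewrite !natrM natrD natr_card_content // !natrX => TE.
apply: (mulfI (x := P ^+ (i * (2 * k.+2)))); first by rewrite expf_neq0.
rewrite TE expr0 mulr1 hornerD.
have c0 := @natr_chart_count k i 0 a b c natr_card_chart0 ia1.
have c1 := @natr_chart_count k i 1 c b a natr_card_chart1 ia1.
have XP : P ^+ (i * (2 * k.+2)) * P ^- k.+2 ^+ (2 * i) = 1.
  by rewrite exprVn -exprM [(k.+2 * _)%N]mulnC mulnA [(i * 2)%N]mulnC -mulnA mulfV ?expf_neq0.
rewrite -[LHS]mulr1 -[X in _ * X = _]XP.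
transitivity (P ^+ (i * (2 * k.+2)) * (P ^+ (N * k.+2) * P ^+ (N * k.+1) * (1 - P ^- k.+2)
   * ((chart_count k i 0 a2 a b c)%:R * P ^+ (i + i) * P ^- k.+2 ^+ (2 * i)
      + (chart_count k i 1 a2 c b a)%:R * P ^+ (i + i) * P ^- k.+2 ^+ (2 * i)))).
  move: (P ^- k.+2 ^+ (2 * i)) (P ^+ (i * (2 * k.+2))) => Xi Pi.
  move: (P ^+ (i + i)) (P ^+ (N * k.+2)) (P ^+ (N * k.+1)) (P ^- k.+2) => *; ring.
rewrite c0 c1.
have -> : P ^+ (N * (4 * k + 5)) = P ^+ (N * k.+2) * P ^+ (N * k.+1) * P ^+ (N * (2 * k + 2)).
  by rewrite -!exprD; congr (_ ^+ _); lia.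
move: (P ^+ (i * (2 * k.+2))) (P ^+ (N * k.+2)) (P ^+ (N * k.+1)) => *; ring.
Qed.
End Density.

(** * Local densities *)

Section Reduction.
Context (p : nat) (p_pr : prime p) (n : nat).
Local Notation N := n.+1.
Local Notation Zp := (padic_int p_pr).
Local Notation red := (@reduction p p_pr N).

Lemma val_reduction (x : Zp) : red x = x N :> nat.
Proof. by rewrite val_natr // residue_mod. Qed.

Fact reduction_is_zmod_morphism : zmod_morphism red.
Proof.
suff redD : {morph red : x y / x + y}.
  by move=> x y; apply/eqP; rewrite eq_sym subr_eq -redD subrK.
by move=> x y; apply: ord_inj; rewrite val_addr // !val_reduction.
Qed.

Fact reduction_is_monoid_morphism : monoid_morphism red.
Proof.
split=> [|x y]; first by apply: ord_inj; rewrite val_reduction; apply/esym/(val_natr p_pr n 1).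
by apply: ord_inj; rewrite val_mulr // !val_reduction.
Qed.

HB.instance Definition _ :=
  GRing.isZmodMorphism.Build Zp 'Z_(p ^ N) red reduction_is_zmod_morphism.
HB.instance Definition _ :=
  GRing.isMonoidMorphism.Build Zp 'Z_(p ^ N) red reduction_is_monoid_morphism.

Lemma dv_reduction j (x : Zp) : (j <= N)%N -> dv j (red x) = pdvd j x.
Proof. by move=> jN; rewrite /dv val_reduction /pdvd -(residue_le x jN). Qed.

Lemma reduction_surj t : exists x : Zp, red x = t.
Proof.
exists (nat_of_ord t)%:R; apply: ord_inj.
by rewrite val_reduction residue_nat modn_small ?val_lt.
Qed.

End Reduction.

(** * Valuations on the fraction field as divisibility of integers *)

Section Valuation.
Context (p : nat) (p_pr : prime p).
Local Notation Zp := (padic_int p_pr).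
Local Notation Qp := (padic p_pr).

Lemma pdvd_factor e j (y : Zp) : ~~ pdvd 1 y -> pdvd j (p%:R ^+ e * y) = (j <= e)%N.
Proof.
move=> ny; rewrite pdvd_sub; have [je|ej] := leqP j e.
  have -> : (j - e = 0)%N by lia.
  exact: pdvd0.
by apply: contraNF ny => dy; apply: pdvd_leq dy; lia.
Qed.

Lemma tofrac_inj : injective (@tofrac Zp).
Proof. by move=> x y xy; apply/eqP; rewrite -tofrac_eq xy. Qed.

Lemma ordp_factor e (y : Zp) : ~~ pdvd 1 y ->
  ordp (tofrac (p%:R ^+ e * y) : Qp) = (e%:R)%:E.
Proof.
move=> ny; have y0 : y != 0 by apply: contraNneq ny => ->; apply/pdvdP; exists 0; rewrite mulr0.
have p0 : (p%:R : Zp) != 0 by rewrite -[p%:R]expr1 natX_eq0.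
have pQ0 : (p%:R : Qp) != 0 by rewrite -(rmorph_nat (@tofrac Zp)) tofrac_eq0.
rewrite /ordp tofrac_eq0 mulf_eq0 natX_eq0 (negbTE y0) /=.
rewrite [X in X%:~R](_ : _ = e%:Z) //.
apply: xget_unique => [|m [u uu]].
  by exists y; rewrite ?padic_unitP // rmorphM rmorphXn rmorph_nat.
rewrite padic_unitP in uu; case: m => m.
  rewrite -exprnP => E.
  have yu : p%:R ^+ e * y = p%:R ^+ m * u.
    by apply: tofrac_inj; rewrite E rmorphM rmorphXn rmorph_nat.
  have me : (m <= e)%N by rewrite -(pdvd_factor e m ny) yu pdvd_factor.
  have em : (e <= m)%N by rewrite -(pdvd_factor m e uu) -yu pdvd_factor.
  by congr Posz; apply/eqP; rewrite eqn_leq me.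
(* A negative exponent would make the unit [u] divisible by [p]. *)
rewrite NegzE -exprnN => E.
have uE : p%:R ^+ m.+1 * (p%:R ^+ e * y) = u.
  apply: tofrac_inj; rewrite [LHS]rmorphM /= E rmorphXn rmorph_nat.
  by rewrite mulVKf // expf_neq0.
by case/negP: uu; rewrite -uE; apply/pdvdP; exists (p%:R ^+ m * (p%:R ^+ e * y)); rewrite exprS; ring.
Qed.

Lemma ord_ge_half (x : Zp) (m : nat) :
  ord_ge (tofrac x : Qp) (m%:R / 2%:R) <-> pdvd (uphalf m) x.
Proof.
have [->|/padic_factor[e [y [-> ny]]]] := eqVneq x 0.
  rewrite /ord_ge /ordp rmorph0 eqxx leey; split=> // _.
  by apply/pdvdP; exists 0; rewrite mulr0.
rewrite /ord_ge ordp_factor // lee_fin pdvd_factor // ler_pdivrMr // -natrM ler_nat.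
by have -> : (m <= e * 2)%N = (uphalf m <= e)%N by lia.
Qed.

Lemma ord_ge_nat (x : Zp) (m : nat) : ord_ge (tofrac x : Qp) m%:R <-> pdvd m x.
Proof.
have -> : (m%:R : rat) = m.*2%:R / 2%:R by rewrite -muln2 natrM mulfK.
by rewrite ord_ge_half uphalf_double.
Qed.

Lemma padic_two_neq0 : (2%:R : Qp) != 0.
Proof.
(* The residue is taken modulo [p ^ 2], which exceeds 2 even for [p = 2]. *)
rewrite -(rmorph_nat (@tofrac Zp)) tofrac_eq0; apply/eqP => /(congr1 (fun x : Zp => x 2)).
rewrite residue_nat [RHS]mod0n modn_small //.
by apply: (@leq_trans (2 ^ 2)) => //; rewrite leq_exp2r ?prime_gt1.
Qed.

End Valuation.

(** * Binary forms and their Gram matrices *)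

Section BinaryForms.
Context (p : nat) (p_pr : prime p).
Local Notation Zp := (padic_int p_pr).
Local Notation Qp := (padic p_pr).
Implicit Types (a b c : Zp) (x y : 'rV[Zp]_2).

Definition bform a b c x : Zp := a * x 0 0 ^+ 2 + b * x 0 0 * x 0 1 + c * x 0 1 ^+ 2.

Lemma ord2_cases (i : 'I_2) : i = 0 \/ i = 1.
Proof. by case: i => -[|[|m]] im; [left|right|]; try apply: val_inj. Qed.

Lemma row2E (R : nzRingType) (v : 'rV[R]_2) : v = v 0 0 *: delta_mx 0 0 + v 0 1 *: delta_mx 0 1.
Proof.
apply/rowP => j; have [->|->] := ord2_cases j; rewrite !mxE /= ?mulr1 ?mulr0 ?addr0 ?add0r //.
Qed.

Lemma mulmx2E (R : nzRingType) m k (A : 'M[R]_(m, 2)) (B : 'M[R]_(2, k)) i j :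
  (A *m B) i j = A i 0 * B 0 j + A i 1 * B 1 j.
Proof.
rewrite mxE big_ord_recl big_ord1; congr (_ + A i _ * B _ j); exact: val_inj.
Qed.

Lemma quadratic_form2 (Q : 'rV[Zp]_2 -> Zp) : quadratic_form Q ->
  Q =1 bform (Q (delta_mx 0 0)) (polar Q (delta_mx 0 0) (delta_mx 0 1)) (Q (delta_mx 0 1)).
Proof.
move=> [Qscale Qpolar] x.
have Q0 : Q 0 = 0 by rewrite -(scale0r 0) Qscale expr2 !mul0r.
have polZ a u v : polar Q (a *: u) v = a * polar Q u v.
  by rewrite -[a *: u]addr0 Qpolar /polar !add0r Q0 subr0 subrr addr0.
have polC u v : polar Q u v = polar Q v u by rewrite /polar [u + v]addrC addrAC.
have Qadd u v : Q (u + v) = polar Q u v + Q u + Q v by rewrite /polar; ring.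
rewrite {1}[x]row2E Qadd polZ polC polZ polC !Qscale /bform; ring.
Qed.

Definition gram2 a b c : 'M[Qp]_2 :=
  \matrix_(i, j) if i == j then tofrac (if i == 0 then a else c) else 2%:R^-1 * tofrac b.

(** Vectors are rows acted on from the right, whereas the Gram matrix changes by [U^T B U]; hence
    the basis change is [U = W^T]. *)
Lemma gk_admissible_gram2 a b c (W : 'M[Zp]_2) a' b' c' (b1 b2 : nat) :
  (forall x, bform a b c (x *m W) = bform a' b' c' x) ->
  gk_admissible ((map_mx (@tofrac Zp) W^T)^T *m gram2 a b c *m map_mx (@tofrac Zp) W^T) [:: b1; b2]
  <-> admissible_coefs a' b' c' b1 b2.
Proof.
move=> WE.
have n2 := padic_two_neq0 p_pr.
have aE : a' = a * W 0 0 ^+ 2 + b * W 0 0 * W 0 1 + c * W 0 1 ^+ 2.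
  have := WE (delta_mx 0 0); rewrite /bform !mulmx2E !mxE /= !mul1r !mul0r !addr0 => ->; ring.
have cE : c' = a * W 1 0 ^+ 2 + b * W 1 0 * W 1 1 + c * W 1 1 ^+ 2.
  have := WE (delta_mx 0 1); rewrite /bform !mulmx2E !mxE /= !mul1r !mul0r !add0r => ->; ring.
have bE : b' = 2%:R * a * W 0 0 * W 1 0 + b * (W 0 0 * W 1 1 + W 0 1 * W 1 0) + 2%:R * c * W 0 1 * W 1 1.
  (* The mixed coefficient is the value at [(1, 1)] minus the two diagonal coefficients. *)
  have := WE (const_mx 1); rewrite /bform !mulmx2E !mxE /= !mul1r aE cE => E.
  have -> : b' = (a' * 1 ^+ 2 + b' * 1 * 1 + c' * 1 ^+ 2) - a' - c' by ring.
  rewrite aE cE -E; ring.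
set M := _ *m _ *m _.
have ME i j : M i j = tofrac (W i 0) * tofrac a * tofrac (W j 0)
   + 2%:R^-1 * tofrac b * (tofrac (W i 0) * tofrac (W j 1) + tofrac (W i 1) * tofrac (W j 0))
   + tofrac (W i 1) * tofrac c * tofrac (W j 1).
  by rewrite /M !mulmx2E !mxE /=; ring.
have M00 : M 0 0 = tofrac a'.
  by rewrite ME aE !(rmorphD, rmorphM, rmorphXn) /=; field.
have M11 : M 1 1 = tofrac c'.
  by rewrite ME cE !(rmorphD, rmorphM, rmorphXn) /=; field.
have M01 i j : i != j -> 2%:R * M i j = tofrac b'.
  move=> ij; rewrite ME bE !(rmorphD, rmorphM, rmorphXn, rmorph_nat) /=.
  by have [iE|iE] := ord2_cases i; have [jE|jE] := ord2_cases j; subst i j => //; field.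
split=> [[_ /= le12 Mii Mij]|/and4P[le12 da dc db]].
  apply/and4P; split.
  - by rewrite andbT in le12.
  - by apply/ord_ge_nat; rewrite -M00; apply: Mii.
  - by apply/ord_ge_nat; rewrite -M11; apply: (Mii 1).
  by apply/ord_ge_half; rewrite -(M01 0 1) //; apply: (Mij 0 1).
split=> //= [|i|i j ij]; first by rewrite le12.
  by have [->|->] := ord2_cases i; rewrite ?M00 ?M11; apply/ord_ge_nat.
rewrite M01 //; apply/ord_ge_half.
have [iE|iE] := ord2_cases i; have [jE|jE] := ord2_cases j; subst i j => //=.
by rewrite addnC.
Qed.

End BinaryForms.

(** * Counting homomorphisms into the hyperbolic space *)

Section Homs.
Context (p : nat) (p_pr : prime p).
Local Notation Zp := (padic_int p_pr).
Local Notation Qp := (padic p_pr).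

Definition form_homs m (Q : 'rV[Zp]_m -> Zp) k N : {set 'M['Z_(p ^ N)]_(m, k + k)} :=
  [set phi | `[< forall x : 'rV[Zp]_m,
     hyperbolic (map_mx (@reduction p p_pr N) x *m phi) = reduction N (Q x) >] ].

(** The reduction of [U] is invertible, so [phi] to [U phi] is a bijection between the two sets. *)
Lemma card_form_homs_basis m (Q : 'rV[Zp]_m -> Zp) (U : 'M[Zp]_m) k n :
  U \in unitmx -> #|form_homs (fun x => Q (x *m U)) k n.+1| = #|form_homs Q k n.+1|.
Proof.
move=> Uu; pose f (phi : 'M['Z_(p ^ n.+1)]_(m, k + k)) := map_mx (@reduction p p_pr n.+1) U *m phi.
pose g (phi : 'M['Z_(p ^ n.+1)]_(m, k + k)) :=
  map_mx (@reduction p p_pr n.+1) (invmx U) *m phi.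
have fK : cancel f g by move=> phi; rewrite /f /g mulmxA -map_mxM mulVmx // map_mx1 mul1mx.
have gK : cancel g f by move=> phi; rewrite /f /g mulmxA -map_mxM mulmxV // map_mx1 mul1mx.
have bij_f : bijective f by exists g.
rewrite -(on_card_preimset (onW_bij _ bij_f)); apply: eq_card => phi; rewrite !inE.
apply: asbool_equiv_eq; split=> H x.
  have := H (x *m invmx U); rewrite mulmxKV // => <-.
  by rewrite /f mulmxA -map_mxM mulmxKV.
by rewrite -H /f map_mxM mulmxA.
Qed.

Lemma mulmx_rows (R : nzRingType) k (v : 'rV[R]_2) (X : 'M[R]_(1 + 1, k)) :
  v *m X = v 0 0 *: usubmx X + v 0 1 *: dsubmx X.
Proof.
apply/rowP => j; rewrite mulmx2E !mxE.
by congr (_ * X _ j + _ * X _ j); apply: val_inj.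
Qed.

Lemma hyperbolic_row_mx (A : comNzRingType) k (v w : 'rV[A]_k) :
  hyperbolic (row_mx v w) = \sum_j v 0 j * w 0 j.
Proof. by apply: eq_bigr => j _; rewrite row_mxEl row_mxEr. Qed.

Lemma card_bform_homs a b c k n :
  #|form_homs (@bform p p_pr a b c) k n.+1|
  = (\sum_(X : 'M['Z_(p ^ n.+1)]_(1 + 1, k))
       gram_count 0 (reduction n.+1 a) (reduction n.+1 b) (reduction n.+1 c) X)%N.
Proof.
rewrite -sum1_card big_mkcond /=.
rewrite (reindex (fun XY : 'M['Z_(p ^ n.+1)]_(1 + 1, k) * 'M['Z_(p ^ n.+1)]_(1 + 1, k) => row_mx XY.1 XY.2)) /=; last first.
  exists (fun phi => (lsubmx phi, rsubmx phi)) => [[X Y]|phi] _ /=.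
    by rewrite row_mxKl row_mxKr.
  exact: hsubmxK.
rewrite -(pair_bigA _ (fun X Y => if row_mx X Y \in form_homs (bform a b c) k n.+1 then 1%N else 0%N)) /=.
apply: eq_bigr => X _; rewrite sum_col_mx /=.
apply: eq_bigr => y1 _; apply: eq_bigr => y2 _.
rewrite inE; set P := (forall x, _); set C := gram_eqs _ _ _ _ _ _ _ _.
suff PC : P <-> C by rewrite (asbool_equiv_eq PC) asboolb; case: C {PC}.
pose x1 := @usubmx _ 1 1 k X; pose x2 := @dsubmx _ 1 1 k X.
have hypE (s t : 'Z_(p ^ n.+1)) : hyperbolic ((\row_j if j == 0 then s else t) *m row_mx X (col_mx y1 y2))
  = s ^+ 2 * dot x1 y1 + s * t * (dot x1 y2 + dot x2 y1) + t ^+ 2 * dot x2 y2.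
  rewrite mul_mx_row hyperbolic_row_mx -/(dot _ _) !mulmx_rows !mxE /= col_mxKu col_mxKd.
  by rewrite !dotDl !dotDr !dotZl !dotZr; ring.
have bformE (s t : Zp) : reduction n.+1 (bform a b c (\row_j if j == 0 then s else t))
  = reduction n.+1 s ^+ 2 * reduction n.+1 a + reduction n.+1 s * reduction n.+1 t * reduction n.+1 b
    + reduction n.+1 t ^+ 2 * reduction n.+1 c.
  by rewrite /bform !mxE /= !expr2 !rmorphD !rmorphM /=; ring.
have mapE (s t : Zp) : map_mx (@reduction p p_pr n.+1) (\row_j if j == 0 then s else t)
  = (\row_j if j == 0 then reduction n.+1 s else reduction n.+1 t) :> 'rV_2.
  by apply/rowP => j; rewrite !mxE; case: eqP.
split=> [H|/and3P[/eqP E1 /eqP E2 /eqP E3] x].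
  (* The values at [(1, 0)], [(0, 1)] and [(1, 1)] recover the three coefficients. *)
  have Hst s t := H (\row_j if j == 0 then s else t).
  have E1 := Hst 1 0; have E2 := Hst 0 1; have E3 := Hst 1 1.
  rewrite !mapE !hypE !bformE !rmorph1 !rmorph0 in E1 E2 E3.
  rewrite !(expr1n, expr0n, mul1r, mul0r, addr0, add0r) /= in E1 E2 E3.
  rewrite /C /gram_eqs !expr0 !mul1r E1 E2 !eqxx andbT /=.
  by move: E3; rewrite E1 E2 => /addIr /addrI /eqP.
have -> : x = \row_j if j == 0 then x 0 0 else x 0 1.
  by apply/rowP => j; rewrite mxE; have [->|->] := ord2_cases j.
rewrite mapE hypE bformE -E1 -E2 -E3 !expr0 !mul1r; ring.
Qed.

Lemma lexi_pair_le (b1 b2 a1 a2 : nat) :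
  (([:: b1; b2] : seqlexi nat) <= ([:: a1; a2] : seqlexi nat))%O ->
  (b1 < a1)%N || (b1 == a1) && (b2 <= a2)%N.
Proof.
by rewrite !lexi_cons /= !leEnat; case: (ltngtP b1 a1) => //= _; case: (ltngtP b2 a2).
Qed.

(** A nonzero difference would have as many distinct roots [p ^ -k] as its size. *)
Lemma polyp_eq (F : numFieldType) (f g : {poly F}) :
  (forall k, (2 <= k)%N -> f.[(p%:R ^+ k)^-1] = g.[(p%:R ^+ k)^-1]) -> f = g.
Proof.
move=> fg; apply/eqP; rewrite -subr_eq0; apply: contraT => nz.
pose rs := [seq (p%:R ^+ k)^-1 : F | k <- iota 2 (size (f - g)%R)].
have : (size rs < size (f - g)%R)%N.
  apply: max_poly_roots => //.
    apply/allP => x /mapP[k]; rewrite mem_iota => /andP[k2 _] ->.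
    by rewrite /root hornerD hornerN fg // subrr.
  rewrite map_inj_uniq ?iota_uniq // => k l /invr_inj.
  rewrite -!natrX => /eqP; rewrite eqr_nat eqn_exp2l ?prime_gt1 // => /eqP //.
by rewrite size_map size_iota ltnn.
Qed.

(** The rank is a variable [m] with [m = 2], so that it can be replaced by 2 in the types of the
    matrices, which is impossible for [dim M] itself. *)
Lemma binary_form_density (F : numFieldType) m (Q : 'rV[Zp]_m -> Zp) (B : 'M[Qp]_m)
    (a1 a2 : nat) :
  m = 2%N -> quadratic_form Q ->
  (forall i j, B i j = if i == j then tofrac (Q (delta_mx 0 i))
     else 2%:R^-1 * tofrac (polar Q (delta_mx 0 i) (delta_mx 0 j))) ->
  (forall x, x != 0 -> Q x != 0) ->
  (exists2 U : 'M[Zp]_m, U \in unitmx & let U' := map_mx (@tofrac Zp) U in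
     gk_admissible (U'^T *m B *m U') [:: a1; a2]) ->
  (forall b : seq nat, (exists2 U : 'M[Zp]_m, U \in unitmx &
     let U' := map_mx (@tofrac Zp) U in gk_admissible (U'^T *m B *m U') b) ->
     ((b : seqlexi nat) <= ([:: a1; a2] : seqlexi nat))%O) ->
  (a1 <= a2)%N /\ forall k n, (a2 < n.+1)%N ->
    #|form_homs Q k.+2 n.+1|%:R
    = p%:R ^+ (n.+1 * (4 * k + 5)) * (siegel_poly F p a1 a2).[p%:R ^- k.+2].
Proof.
move=> m2; subst m => Qq BE Qaniso Qadm Qmax.
have QE := quadratic_form2 Qq.
set a0 := Q _ in QE; set b0 := polar _ _ _ in QE; set c0 := Q _ in QE.
have B2 : B = gram2 a0 b0 c0.
  have polC u v : polar Q u v = polar Q v u by rewrite /polar [u + v]addrC addrAC.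
  apply/matrixP => i j; rewrite BE mxE.
  by have [->|->] := ord2_cases i; have [->|->] := ord2_cases j; rewrite //= polC.
(* The coefficient triples of [Q] in the bases given by the rows of invertible [W]. *)
pose S a b c := exists2 W : 'M[Zp]_2, W \in unitmx & forall x, Q (x *m W) = bform a b c x.
have admE a b c W b1 b2 : (forall x, Q (x *m W) = bform a b c x) ->
    gk_admissible ((map_mx (@tofrac Zp) W^T)^T *m B *m map_mx (@tofrac Zp) W^T) [:: b1; b2]
    <-> admissible_coefs a b c b1 b2.
  by move=> WE; rewrite B2; apply: gk_admissible_gram2 => x; rewrite -QE.
have [a [b [c [[W Wu WE] [da db dc dq0 dq1]]]]] : exists a b c, S a b c /\ diagonal_orders a b c a1 a2.
  apply: exists_diagonal_orders.
  - move=> a b c t [W Wu WE].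
    pose T s : 'M[Zp]_2 := \matrix_(i, j) if i == j then 1 else if i == 0 then 0 else s.
    have TT : T t *m T (- t) = 1%:M.
      apply/matrixP => i j; rewrite mulmx2E !mxE.
      by have [->|->] := ord2_cases i; have [->|->] := ord2_cases j; rewrite /=; ring.
    exists (T t *m W); first by rewrite unitmx_mul Wu (proj1 (mulmx1_unit TT)).
    move=> x; rewrite mulmxA WE /bform !mulmx2E !mxE /=; ring.
  - move=> a b c [W Wu WE].
    pose T : 'M[Zp]_2 := \matrix_(i, j) (i != j)%:R.
    have TT : T *m T = 1%:M.
      apply/matrixP => i j; rewrite mulmx2E !mxE.
      by have [->|->] := ord2_cases i; have [->|->] := ord2_cases j; rewrite /=; ring.
    exists (T *m W); first by rewrite unitmx_mul Wu (proj1 (mulmx1_unit TT)).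
    move=> x; rewrite mulmxA WE /bform !mulmx2E !mxE /=; ring.
  - move=> a b c t [W Wu WE].
    (* The vector [(t, 1)] is nonzero whatever [t] is, so anisotropy applies to it. *)
    pose x : 'rV[Zp]_2 := \row_j if j == 0 then t else 1.
    have x0 : x != 0.
      by apply/eqP => /rowP/(_ 1); rewrite !mxE /= => /eqP; rewrite oner_eq0.
    have /Qaniso : x *m W != 0.
      by apply: contraNneq x0 => xW; rewrite -[x](mulmxK Wu) xW mul0mx.
    rewrite WE /bform !mxE /= => /eqP H E; apply: H; rewrite -E; ring.
  - move=> a b c b1 b2 [W Wu WE] adm; apply: lexi_pair_le; apply: Qmax.
    by exists W^T; [rewrite unitmx_tr|apply/(admE _ _ _ _ _ _ WE)].
  have [U Uu adm] := Qadm.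
  (* The columns of the [U] realizing [GK] form the starting basis. *)
  exists (Q (row 0 U^T)), (polar Q (row 0 U^T) (row 1 U^T)), (Q (row 1 U^T)).
  have WE x : Q (x *m U^T) = bform (Q (row 0 U^T)) (polar Q (row 0 U^T) (row 1 U^T)) (Q (row 1 U^T)) x.
    have Qq' : quadratic_form (fun x => Q (x *m U^T)).
      case: Qq => Qs Qp'; split=> [s y|s y z w]; first by rewrite -scalemxAl Qs.
      by rewrite /polar !mulmxDl -!scalemxAl; apply: Qp'.
    by rewrite (quadratic_form2 Qq' x) /polar mulmxDl -!rowE.
  split; first by exists U^T; rewrite ?unitmx_tr.
  by apply/(admE _ _ _ _ _ _ WE); rewrite trmxK.
have le12 : (a1 <= a2)%N by have [U _ [_ /=]] := Qadm; rewrite andbT.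
split=> // k n a2n.
rewrite -(card_form_homs_basis Q k.+2 n Wu).
have -> : (fun x => Q (x *m W)) = bform a b c by apply: funext.
rewrite card_bform_homs (natr_sum_gram_count F p_pr le12 a2n) ?dv_reduction //; try lia.
- move=> t j jN; have [s <-] := reduction_surj p_pr t.
  have -> : qval (reduction n.+1 a) (reduction n.+1 b) (reduction n.+1 c) (reduction n.+1 s)
     = reduction n.+1 (c - s * b + s ^+ 2 * a).
    by rewrite /qval !expr2 rmorphD rmorphB !rmorphM.
  by rewrite dv_reduction // dq0 dv_reduction //; lia.
- move=> t j jN; have [s <-] := reduction_surj p_pr t.
  rewrite dv_reduction // => ds.
  have -> : qval (reduction n.+1 c) (reduction n.+1 b) (reduction n.+1 a) (reduction n.+1 s)
     = reduction n.+1 (a - s * b + s ^+ 2 * c).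
    by rewrite /qval !expr2 rmorphD rmorphB !rmorphM.
  by rewrite dv_reduction // dq1.
Qed.

End Homs.

(** The sequence defining the density is constant as soon as [N > a2], so its limit is this
    constant. *)
Lemma local_density_binary (R : realType) (p : nat) (p_pr : prime p)
    (M : quad_lattice p_pr) (a1 a2 : nat) :
  rank M = 2%N -> anisotropic M -> is_GK M [:: a1; a2] ->
  (a1 <= a2)%N /\ forall k, (2 <= k)%N ->
    local_density R M k = (siegel_poly R p a1 a2).[(p%:R ^+ k)^-1].
Proof.
move=> rkM aniM [gkM maxM].
pose Q (x : 'rV[padic_int p_pr]_(dim M)) := qform (r2v x : M).
have Qq : quadratic_form Q.
  have [qs qp] := qform_quadratic M.
  split=> [s x|s x y z]; first by rewrite /Q linearZ qs.
  by rewrite /polar /Q !linearD linearZ; apply: qp.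
have Qaniso x : x != 0 -> Q x != 0.
  move=> x0; apply: aniM; apply: contraNneq x0 => x0.
  by rewrite -[x]r2vK x0 linear0.
have BE i j : gram (@qform _ _ M) i j = if i == j then tofrac (Q (delta_mx 0 i))
     else 2%:R^-1 * tofrac (polar Q (delta_mx 0 i) (delta_mx 0 j)).
  by rewrite mxE /polar /Q linearD.
have [le12 homsE] := @binary_form_density p p_pr R (dim M) Q _ a1 a2 rkM Qq BE Qaniso gkM maxM.
split=> // -[|[|k]] // _; apply: lim_near_cst; first exact: norm_hausdorff.
near=> n; rewrite (_ : lattice_homs M k.+2 n.+1 = form_homs Q k.+2 n.+1); last first.
  apply/setP => phi; rewrite !inE; apply: asbool_equiv_eq; split=> H x.
    by have := H (r2v x); rewrite r2vK.
  by have := H (v2r x); rewrite /Q v2rK.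
rewrite homsE; last by rewrite ltnS; near: n; exact: nbhs_infty_ge.
rewrite rkM.
have -> : (2 * k.+2 * 2 - (2 * 3)./2 = 4 * k + 5)%N by lia.
by rewrite mulrAC mulfV ?mul1r // expf_neq0 // pnatr_eq0 -lt0n prime_gt0.
Unshelve. all: by end_near.
Qed.

Theorem theorem6p7 (R : realType) (p : nat) (p_pr : prime p)
    (M : quad_lattice p_pr) (a1 a2 : nat) :
  rank M = 2%N -> anisotropic M -> is_GK M [:: a1; a2] ->
  (T_sum p a1 a2)%:R = -1 / (p%:R - 1) * (siegel_series R M)^`().[p%:R^-1].
Proof.
move=> rkM aniM gkM; have [le12 densE] := local_density_binary R rkM aniM gkM.
have -> : siegel_series R M = siegel_poly R p a1 a2.
  (* The densities determine the polynomial, as it is prescribed at the infinitely many points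
     [p ^ -k]. *)
  apply: xget_unique => [k|f fE]; first by rewrite rkM => /densE.
  by apply: (polyp_eq p_pr) => k k2; rewrite fE ?rkM // densE.
rewrite deriv_siegel_poly // T_sum_eq // natr_sum.
have p1 : (p%:R - 1 : R) != 0 by rewrite subr_eq0 pnatr_eq1 neq_ltn prime_gt1 ?orbT.
have -> S : -1 / (p%:R - 1) * (- (p%:R - 1) * S) = S :> R by field.
rewrite big_mkord.
by apply: eq_bigr => i _; apply: sum_half_powers => //; rewrite -ltnS.
Qed.
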